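(* Let $X$ be a proper metric space and let $L$ be a compact metric absolute Lipschitz neighborhood euclidean extensor (ALNER) of diameter $\le 1$. The following conditions are equivalent: (1) $\mathrm{as\text{-}ext\text{-}dim}\,X\le[\mathcal{O}L]$; (2) $\mathrm{ext\text{-}dim}\,\nu X\le[L]$, where $\nu X$ is the Higson corona of $X$.
   Context: A metric space is proper if every closed ball in it is compact. A map $f\colon X\to Y$ of metric spaces is asymptotically Lipschitz if there are $\lambda,\varepsilon>0$ with $d(f(x),f(x'))\le\lambda d(x,x')+\varepsilon$ for all $x,x'\in X$; it is proper if the preimage of every compact set is compact. ALNER: a compact metric space $L$ is an absolute Lipschitz neighborhood euclidean extensor if, up to bi-Lipschitz equivalence, it is a subset of a cube $I^n=[0,1]^n$ for some $n$ and there is a Lipschitz retraction $r\colon U\to L$ of some neighborhood $U$ of $L$ in $I^n$. $\mathcal{L}$ denotes the class of compact ALNERs. Open cone: for a metric space $L$ of diameter $\le 1$, $\mathcal{O}L=(L\times\mathbb{R}_+)/(L\times\{0\})$, where $\mathbb{R}_+=[0,\infty)$, with metric $d([x_1,t_1],[x_2,t_2])=|t_1-t_2|+\min\{t_1,t_2\}\,d(x_1,x_2)$, where $[x,t]$ is the class of $(x,t)$. Kuratowski notation: for proper metric spaces $X,P$, $X\tau P$ means that every proper asymptotically Lipschitz map $f\colon A\to P$ defined on a closed subset $A$ of $X$ has a proper asymptotically Lipschitz extension $X\to P$. Asymptotic extension dimension: for $L_1,L_2\in\mathcal{L}$ put $L_1\le L_2$ iff $X\tau\mathcal{O}L_1$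 implies $X\tau\mathcal{O}L_2$ for all proper metric spaces $X$; $[L]$ is the class of $L$ for the induced equivalence relation. By definition, $\mathrm{as\text{-}ext\text{-}dim}\,X\le[\mathcal{O}L]$ means $X\tau\mathcal{O}L$. Extension dimension (Dranishnikov): for a compact Hausdorff space $Z$, $\mathrm{ext\text{-}dim}\,Z\le[L]$ means that every continuous map $C\to L$ defined on a closed subset $C$ of $Z$ extends to a continuous map $Z\to L$. Higson corona: a function $\varphi\colon X\to\mathbb{R}$ is slowly oscillating if for every $r>0$ and every $\varepsilon>0$ there is a compact $K\subset X$ such that $\sup\{|\varphi(y)-\varphi(x)| : d(x,y)<r\}<\varepsilon$ for all $x\in X\setminus K$. The Higson compactification $\bar X$ is the compactification of $X$ corresponding to the family of all continuous bounded slowly oscillating functions on $X$, and the Higson corona is $\nu X=\bar X\setminus X$. *)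

(* Defs.v *)
From HB Require Import structures.
From mathcomp Require Import all_boot all_order all_algebra.
From mathcomp Require Import all_classical all_reals all_analysis.
From mathcomp Require Import ring lra.

Set Implicit Arguments.
Unset Strict Implicit.
Unset Printing Implicit Defensive.

Import Order.TTheory GRing.Theory Num.Theory.
Import numFieldNormedType.Exports.

Local Open Scope classical_set_scope.
Local Open Scope ring_scope.
Local Open Scope quotient_scope.

(* The library makes [set_type A] a pseudometric space, with the balls of the
   ambient space; this adds the restricted distance. *)
Section subspace_metric.
Context {R : realType} {X : metricType R} (A : set X).

Let dist (x y : A) : R := mdist (set_val x) (set_val y).

Let dist_ge0 x y : 0 <= dist x y.
Proof. exact: mdist_ge0. Qed.

Let dist_positivity x y : dist x y = 0 -> x = y.
Proof. by move=> /mdist_positivity; exact: val_inj. Qed.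

Let ballEdist (x : A) d : ball x d = [set y | dist x y < d].
Proof.
apply/funext => y; rewrite -[LHS]/(ball (set_val x) d (set_val y)).
by rewrite ballEmdist.
Qed.

HB.instance Definition _ :=
  PseudoMetric_isMetric.Build R (set_type A) dist_ge0 dist_positivity ballEdist.

End subspace_metric.

(* [closed_ball] of the library is the closure of the open ball, which can be
   smaller than the closed ball used here. *)
Definition proper_space {R : realType} (X : metricType R) : Prop :=
  forall (x : X) (r : R), compact [set y | mdist x y <= r].

Definition asymptotically_lipschitz {R : realType} {X Y : metricType R}
    (f : X -> Y) : Prop :=
  exists l e : R, [/\ 0 < l, 0 < e &
    forall x x', mdist (f x) (f x') <= l * mdist x x' + e].

Definition proper_map {X Y : topologicalType} (f : X -> Y) : Prop :=
  forall K : set Y, compact K -> compact (f @^-1` K).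

(* Continuity of [f] and [g] is not imposed: when closed balls of [P] are
   compact, a proper asymptotically Lipschitz map into [P] is continuous. *)
Definition kuratowski_tau {R : realType} (X P : metricType R) : Prop :=
  forall (A : set X) (f : A -> P), closed A ->
    proper_map f -> asymptotically_lipschitz f ->
  exists g : X -> P, [/\ proper_map g, asymptotically_lipschitz g &
    forall a : A, g (set_val a) = f a].

Definition as_ext_dim_le {R : realType} (X P : metricType R) : Prop :=
  kuratowski_tau X P.

Definition ext_dim_le (Z L : topologicalType) : Prop :=
  forall (C : set Z) (f : C -> L), closed C -> continuous f ->
  exists g : Z -> L, continuous g /\ forall c : C, g (set_val c) = f c.

Definition cube (R : realType) (n : nat) : set 'rV[R]_n :=
  [set v | forall i, 0 <= v ord0 i <= 1].
Arguments cube : clear implicits.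

Definition bilipschitz_embedding {R : realType} {L : metricType R} {n : nat}
    (e : L -> 'rV[R]_n) : Prop :=
  exists a b : R, [/\ 0 < a, 0 < b &
    forall x y, a * mdist x y <= `|e x - e y| <= b * mdist x y].

(* 'rV[R]_n carries the sup norm, which is bi-Lipschitz equivalent to the
   Euclidean one. *)
Definition compact_ALNER {R : realType} (L : metricType R) : Prop :=
  compact [set: L] /\
  exists (n : nat) (e : L -> 'rV[R]_n) (U : set 'rV[R]_n)
         (r : 'rV[R]_n -> 'rV[R]_n),
    [/\ bilipschitz_embedding e,
        range e `<=` cube R n,
        (U `<=` cube R n /\
         exists W, [/\ open W, range e `<=` W & W `&` cube R n `<=` U]),
        [lipschitz r x | x in U] &
        (r @` U `<=` range e /\ forall y, range e y -> r y = y)].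

Definition diameter_le1 {R : realType} (L : metricType R) : Prop :=
  forall x y : L, mdist x y <= 1.

Section open_cone.
Context {R : realType} {L : metricType R}.

Definition cone_rel (p q : L * {nonneg R}) : bool :=
  (p == q) || (p.2%:num == 0) && (q.2%:num == 0).

Lemma cone_rel_refl : reflexive cone_rel.
Proof. by move=> p; rewrite /cone_rel eqxx. Qed.

Lemma cone_rel_sym : symmetric cone_rel.
Proof. by move=> p q; rewrite /cone_rel eq_sym andbC. Qed.

Lemma cone_rel_trans : transitive cone_rel.
Proof.
move=> q p s; rewrite /cone_rel => /orP[/eqP->//|/andP[p0 q0]].
by move=> /orP[/eqP<-|/andP[_ s0]]; rewrite p0 ?q0 ?s0 orbT.
Qed.

Canonical cone_equiv := EquivRel cone_rel cone_rel_refl cone_rel_sym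
  cone_rel_trans.

(* The diameter bound is a parameter of the type because the triangle
   inequality depends on it. *)
Definition open_cone (hL : diameter_le1 L) := {eq_quot cone_equiv}.

Definition precone_dist (p q : L * {nonneg R}) : R :=
  `|p.2%:num - q.2%:num| + Num.min p.2%:num q.2%:num * mdist p.1 q.1.

Lemma precone_dist_sym p q : precone_dist p q = precone_dist q p.
Proof. by rewrite /precone_dist distrC minC metric_sym. Qed.

Lemma precone_dist_rel p p' q :
  cone_rel p p' -> precone_dist p q = precone_dist p' q.
Proof.
move=> /orP[/eqP->//|/andP[/eqP p0 /eqP p'0]].
by rewrite /precone_dist p0 p'0 min_l ?mul0r.
Qed.

Lemma precone_dist_triangle (hL : diameter_le1 L) q p s :
  precone_dist p s <= precone_dist p q + precone_dist q s.
Proof.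
case: p q s => [x t] [y u] [z v]; rewrite /precone_dist /=.
have t0 : 0 <= t%:num by []. have u0 : 0 <= u%:num by [].
have v0 : 0 <= v%:num by [].
move: t0 u0 v0; move: (t%:num) (u%:num) (v%:num) => {}t {}u {}v t0 u0 v0.
have := metric_triangle x y z.
have := hL x z; have := mdist_ge0 x y; have := mdist_ge0 y z.
have := mdist_ge0 x z.
move: (mdist x z) (mdist x y) (mdist y z) => a b c a0 c0 b0 a1 abc.
wlog tv : t v b c t0 v0 a0 b0 c0 abc / t <= v.
  move=> H; have /orP[tv|tv] := le_total t v; first exact: H.
  have := H v t c b v0 t0 a0 c0 b0.
  rewrite [c + b]addrC => /(_ abc tv).
  by rewrite (distrC v t) (minC v t) (distrC v u) (minC v u) (distrC u t)
    (minC u t) [leRHS]addrC.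
rewrite (min_l tv) (ler0_norm (x := t - v)) ?subr_le0//.
have [tu|/ltW ut] := leP t u.
  rewrite (ler0_norm (x := t - u)) ?subr_le0//.
  have [uv|/ltW vu] := leP u v.
    rewrite (ler0_norm (x := u - v)) ?subr_le0//.
    by have := ler_wpM2l t0 abc; have := ler_wpM2r c0 tu; lra.
  rewrite (ger0_norm (x := u - v)) ?subr_ge0//.
  by have := ler_wpM2l t0 abc; have := ler_wpM2r c0 tv; lra.
rewrite (ger0_norm (x := t - u)) ?subr_ge0//.
have uv := le_trans ut tv.
rewrite (min_l uv) (ler0_norm (x := u - v)) ?subr_le0//.
have tu0 : 0 <= t - u by rewrite subr_ge0.
by have := ler_wpM2l u0 abc; have := ler_wpM2l tu0 a1; lra.
Qed.

Lemma precone_dist_eq0 p q : precone_dist p q = 0 -> cone_rel p q.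
Proof.
move: p q => [x t] [y u]; rewrite /precone_dist /cone_rel /= => /eqP.
rewrite paddr_eq0 ?mulr_ge0 ?mdist_ge0 ?le_min ?normr_ge0//; last first.
  by apply/andP.
rewrite normr_eq0 subr_eq0 => /andP[/eqP/val_inj <-].
rewrite minxx mulf_eq0 => /orP[->|/eqP/mdist_positivity->].
  by rewrite orbT.
by rewrite eqxx.
Qed.

Section metric.
Variable hL : diameter_le1 L.

HB.instance Definition _ := Choice.on (open_cone hL).

Definition cone_pt (x : L) (t : {nonneg R}) : open_cone hL :=
  \pi_{eq_quot cone_equiv} (x, t).

Definition cone_dist (p q : open_cone hL) : R :=
  precone_dist (repr p) (repr q).

Let cone_distxx p : cone_dist p p = 0.
Proof. by rewrite /cone_dist /precone_dist subrr normr0 mdistxx mulr0 addr0. Qed.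

Let cone_dist_positivity p q : cone_dist p q = 0 -> p = q.
Proof.
move=> /precone_dist_eq0 pq; rewrite -[p]reprK -[q]reprK.
exact/eqmodP.
Qed.

Let cone_dist_sym p q : cone_dist p q = cone_dist q p.
Proof. exact: precone_dist_sym. Qed.

Let cone_dist_triangle q p s :
  cone_dist p s <= cone_dist p q + cone_dist q s.
Proof. exact: precone_dist_triangle. Qed.

HB.instance Definition _ := isMetric.Build R (open_cone hL)
  cone_distxx cone_dist_positivity cone_dist_sym cone_dist_triangle.

Lemma mdist_coneE (x y : L) (t u : {nonneg R}) :
  mdist (cone_pt x t) (cone_pt y u) =
  `|t%:num - u%:num| + Num.min t%:num u%:num * mdist x y.
Proof.
have rel p : cone_rel (repr (\pi_{eq_quot cone_equiv} p)) p.
  by apply/eqmodP; rewrite reprK.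
rewrite [LHS](precone_dist_rel _ (rel (x, t))).
by rewrite precone_dist_sym (precone_dist_rel _ (rel (y, u))) precone_dist_sym.
Qed.

End metric.
End open_cone.

Section higson.
Context {R : realType} (X : metricType R).

Definition slowly_oscillating (phi : X -> R) : Prop :=
  forall r e : R, 0 < r -> 0 < e -> exists K : set X, compact K /\
    forall x, ~ K x ->
    (ereal_sup [set `|phi y - phi x|%:E | y in [set y | (mdist x y < r)%R]]
       < e%:E)%E.

Definition higson_functions : set (X -> R) :=
  [set phi | [/\ continuous phi, bounded_fun phi & slowly_oscillating phi]].

Definition higson_product : topologicalType :=
  prod_topology (fun _ : higson_functions => R^o).

Definition higson_embedding (x : X) : higson_product :=
  fun phi => set_val phi x.

(* The compactification attached to a family of bounded functions is the
   closure of the image of the space in the product indexed by the family. *)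
Definition higson_compactification : set higson_product :=
  closure (range higson_embedding).

Definition higson_corona : set higson_product :=
  higson_compactification `\` range higson_embedding.

End higson.
Arguments higson_functions {R} X.
Arguments higson_compactification {R} X.
Arguments higson_corona {R} X.

(* Main.v *)
Require Import Defs.
From mathcomp Require Import all_boot all_order all_algebra.
From mathcomp Require Import all_classical all_reals all_analysis.
From mathcomp Require Import ring lra.

(* Write e : L -> R^n for the bi-Lipschitz embedding and r for a Lipschitz
   retraction of a neighborhood of e(L) onto e(L). The point [x, t] of the open
   cone is recorded by its coordinates (t e(x), t), which determine the metric
   of the cone up to a constant.

   (1) => (2): a map from a closed C of the corona to L is, coordinatewise, the
   restriction of a Higson map psi : X -> R^n (Tietze on the compactification,
   whose continuous functions restrict to slowly oscillating functions). There
   is a proper Lipschitz s >= 0 with s(x)|psi x - psi y| <= 1 + d(x, y), so that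
   [r psi, s] is a proper asymptotically Lipschitz map into the cone on the
   closed set where psi is close to e(L). Extend it to X by (1); if (k, t) are
   the coordinates of the extension, the quotient k / t is slowly oscillating
   and induces the required extension on the corona.

   (2) => (1): extend the coordinates of f to (v, t) on X, with t proper and
   |v| <= t. Where v / t is close to e(L), (r(v / t), h) with
   h = max(0, t - 4 dist(v, t e(L))) defines an asymptotically Lipschitz map
   into the cone, which is an extension of f, but h need not be proper. The
   map r(v / t) is slowly oscillating; by (2) it extends from a closed part of
   the corona to all of it, hence to a slowly oscillating map g with values in
   L off a bounded set, which is r(v / t) where h > 0. A slowly growing proper
   s <= t that vanishes on the bounded set makes [g, s] asymptotically
   Lipschitz, and the extension of f has radial coordinate max(h, s). *)

Set Implicit Arguments.
Unset Strict Implicit.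
Unset Printing Implicit Defensive.
Import Order.TTheory GRing.Theory Num.Theory numFieldNormedType.Exports.
Local Open Scope classical_set_scope.
Local Open Scope ring_scope.

(** * Sup norm estimates, and continuity by domination *)

Section norms.
Context {R : realType}.

Lemma row_norm_le n (u : 'rV[R]_n) (c : R) :
  0 <= c -> (forall i, `|u ord0 i| <= c) -> `|u| <= c.
Proof.
move=> c0 h; rewrite [leLHS]/Num.Def.normr/= mx_normrE.
by apply: bigmax_le => // -[i j] _ /=; rewrite ord1.
Qed.

Lemma row_coord_le n (u : 'rV[R]_n) i : `|u ord0 i| <= `|u|.
Proof.
rewrite [leRHS]/Num.Def.normr/= mx_normrE.
exact: (le_bigmax _ (fun ij => `|u ij.1 ij.2|) (ord0, i)).
Qed.

Definition lip {V W : normedModType R} (f : V -> W) :=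
  exists2 C : R, 0 <= C & forall x y, `|f x - f y| <= C * `|x - y|.

(** Differences, norms, coordinates and Lipschitz images all obtain their continuity from this one
    estimate. *)
Lemma continuous_dominated {T : topologicalType} {V W U : normedModType R}
    (f : T -> V) (g : T -> W) (h : T -> U) (C : R) :
  continuous f -> continuous g ->
  (forall x y, `|h x - h y| <= C * (`|f x - f y| + `|g x - g y|)) ->
  continuous h.
Proof.
move=> cf cg H x; apply/cvgrPdist_lt => e e0.
have C0 : 0 < `|C| + 1 by rewrite ltr_wpDl.
have d0 : 0 < e / (2 * (`|C| + 1)) by rewrite divr_gt0// mulr_gt0.
have /cvgrPdist_lt/(_ _ d0) hf := cf x.
have /cvgrPdist_lt/(_ _ d0) hg := cg x.
near=> y; apply: le_lt_trans (H x y) _.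
have fy : `|f x - f y| < e / (2 * (`|C| + 1)) by near: y.
have gy : `|g x - g y| < e / (2 * (`|C| + 1)) by near: y.
apply: (@le_lt_trans _ _ ((`|C| + 1) * (`|f x - f y| + `|g x - g y|))).
  by rewrite ler_wpM2r ?addr_ge0//; have := ler_norm C; lra.
have -> : e = (`|C| + 1) * (e / (2 * (`|C| + 1)) + e / (2 * (`|C| + 1))).
  by field; rewrite gt_eqF.
by rewrite ltr_pM2l// ltrD.
Unshelve. all: by end_near. Qed.

Lemma continuous_subf {T : topologicalType} {V : normedModType R} (f g
  : T -> V) :
  continuous f -> continuous g -> continuous (fun x => f x - g x).
Proof.
move=> cf cg; apply: (continuous_dominated (C := 1) cf cg) => x y.
by rewrite mul1r opprD addrACA (le_trans (ler_normD _ _))// -opprD normrN.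
Qed.

Lemma continuous_scale {T : topologicalType} {V : normedModType R} (f
  : T -> R) (g : T -> V) :
  continuous f -> continuous g -> continuous (fun x => f x *: g x).
Proof. by move=> cf cg x; apply: cvgZ; [exact: cf|exact: cg]. Qed.

Lemma continuous_normf {T : topologicalType} {V : normedModType R} (f : T -> V)
  :
  continuous f -> continuous (fun x => `|f x|).
Proof.
move=> cf; apply: (continuous_dominated (C := 1) cf cf) => x y.
by rewrite mul1r; apply: le_trans (ler_dist_dist _ _) _; rewrite lerDl.
Qed.

Lemma continuous_lip {T : topologicalType} {V W : normedModType R}
    (f : T -> V) (h : V -> W) : lip h -> continuous f -> continuous (h \o f).
Proof.
move=> [C C0 hC] cf; apply: (continuous_dominated (C := C) cf cf) => x y /=.
by apply: le_trans (hC _ _) _; rewrite ler_wpM2l// lerDl.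
Qed.

Lemma continuous_row {T : topologicalType} n (f : T -> 'rV[R]_n) :
  (forall i, continuous (fun x => f x ord0 i)) -> continuous f.
Proof.
move=> cf x; apply/cvgrPdist_le => e e0.
have : \forall y \near x, forall i, `|f x ord0 i - f y ord0 i| <= e.
  have H i : \forall y \near x, `|f x ord0 i - f y ord0 i| <= e.
    by have /cvgrPdist_le/(_ _ e0) := cf i x.
  exact: filter_forall.
apply: filterS => y h.
by apply: row_norm_le => [|i]; [exact: ltW|rewrite !mxE].
Qed.

Lemma continuous_coord {T : topologicalType} n (f : T -> 'rV[R]_n) i :
  continuous f -> continuous (fun x => f x ord0 i).
Proof.
move=> cf; apply: (continuous_dominated (C := 1) cf cf) => x y.
rewrite mul1r; have := row_coord_le (f x - f y) i; rewrite !mxE => h.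
by apply: le_trans h _; rewrite lerDl.
Qed.

Lemma max_dist (a b c d : R)
  : `|Num.max a b - Num.max c d| <= `|a - c| + `|b - d|.
Proof.
have := ler_norm (a - c); have := ler_norm (b - d); have := ler_norm (-(a - c)).
have := ler_norm (-(b - d)); rewrite !normrN => *.
rewrite ler_norml; case: (leP a b); case: (leP c d) => *; lra.
Qed.

Lemma min_dist (a b c d : R)
  : `|Num.min a b - Num.min c d| <= `|a - c| + `|b - d|.
Proof.
have := ler_norm (a - c); have := ler_norm (b - d); have := ler_norm (-(a - c)).
have := ler_norm (-(b - d)); rewrite !normrN => *.
rewrite ler_norml; case: (leP a b); case: (leP c d) => *; lra.
Qed.

Lemma scale_dist {V : normedModType R} (a b : R) (u v : V) :
  `|a *: u - b *: v| <= `|a| * `|u - v| + `|a - b| * `|v|.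
Proof.
have -> : a *: u - b *: v = a *: (u - v) + (a - b) *: v.
  by rewrite scalerBr scalerBl addrA subrK.
by rewrite (le_trans (ler_normD _ _))// !normrZ.
Qed.

End norms.

(** * Asymptotically Lipschitz maps into normed spaces *)

Section asymptotically_Lipschitz.
Context {R : realType} {X : metricType R}.

Lemma continuous_metricP {V : normedModType R} (f : X -> V) :
  continuous f <->
  forall x e, 0 < e -> exists2 d, 0 < d & forall y,
    mdist x y < d -> `|f x - f y| < e.
Proof.
split=> [cf x e e0|H x].
  have /cvgrPdist_lt/(_ _ e0) := cf x.
  by move=> /metricType_numDomainType.nbhs_mdistP [d d0 h]; exists d.
apply/cvgrPdist_lt => e e0; have [d d0 h] := H x e e0.
by apply/metricType_numDomainType.nbhs_mdistP; exists d.
Qed.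

Lemma continuous_mdist (a : X) : continuous (mdist a : X -> R).
Proof.
apply/continuous_metricP => x e e0; exists e => // y; apply: le_lt_trans.
have := metric_triangle a x y; have := metric_triangle a y x.
by rewrite (metric_sym y x) ler_norml => *; apply/andP; split; lra.
Qed.

(* An additive and a multiplicative constant can be merged into one. *)
Definition coarse_lip {V : normedModType R} (f : X -> V) :=
  continuous f /\ exists2 c : R, 0 <= c &
    forall x y, `|f x - f y| <= c * (1 + mdist x y).

(** Maxima, minima, sums, differences and coordinates are instances of this estimate. *)
Lemma coarse_lip_dominated {V W U : normedModType R}
    (f : X -> V) (g : X -> W) (h : X -> U) (C : R) : 0 <= C ->
  coarse_lip f -> coarse_lip g ->
  (forall x y, `|h x - h y| <= C * (`|f x - f y| + `|g x - g y|)) ->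
  coarse_lip h.
Proof.
move=> C0 [cf [c c0 fc]] [cg [d d0 gd]] H; split.
  exact: continuous_dominated cf cg H.
exists (C * (c + d)); first by rewrite mulr_ge0// addr_ge0.
move=> x y; apply: le_trans (H x y) _; rewrite -mulrA ler_wpM2l//.
by rewrite mulrDl lerD.
Qed.

Lemma coarse_lip_row n (f : X -> 'rV[R]_n) :
  (forall i, coarse_lip (fun x => f x ord0 i)) -> coarse_lip f.
Proof.
move=> H; split; first by apply: continuous_row => i; case: (H i).
have /choice[c hc] : forall i, exists c : R, 0 <= c /\
    forall x y, `|f x ord0 i - f y ord0 i| <= c * (1 + mdist x y).
  by move=> i; have [_ [c c0 hc]] := H i; exists c.
exists (\sum_i c i); first by apply: sumr_ge0 => i _; case: (hc i).
move=> x y; have h0 : 0 <= 1 + mdist x y by rewrite addr_ge0 ?mdist_ge0.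
have s0 : 0 <= \sum_i c i by apply: sumr_ge0 => i _; case: (hc i).
apply: row_norm_le => [|i]; first by rewrite mulr_ge0.
rewrite !mxE; apply: le_trans (proj2 (hc i) x y) _.
rewrite ler_wpM2r// (bigD1 i)//= lerDl sumr_ge0// => j _.
by case: (hc j).
Qed.

Lemma coarse_lip_coord n (f : X -> 'rV[R]_n) i :
  coarse_lip f -> coarse_lip (fun x => f x ord0 i).
Proof.
move=> cf; apply: (coarse_lip_dominated (C := 1) _ cf cf) => // x y.
rewrite mul1r; have := row_coord_le (f x - f y) i; rewrite !mxE => h.
by apply: le_trans h _; rewrite lerDl.
Qed.

Lemma coarse_lip_lipschitz {V : normedModType R} (f : X -> V) (c : R) :
  0 <= c -> (forall x y, `|f x - f y| <= c * mdist x y) -> coarse_lip f.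
Proof.
move=> c0 H; split.
  apply/continuous_metricP => x e e0; exists (e / (c + 1)).
    by rewrite divr_gt0// ltr_wpDl.
  move=> y; rewrite ltr_pdivlMr ?ltr_wpDl// => h; apply: le_lt_trans (H x y) _.
  by have := mdist_ge0 x y; lra.
exists c => // x y; apply: le_trans (H x y) _.
by rewrite ler_wpM2l// lerDr.
Qed.

Lemma coarse_lip_max (f g : X -> R) :
  coarse_lip f -> coarse_lip g -> coarse_lip (fun x => Num.max (f x) (g x)).
Proof.
move=> cf cg; apply: (coarse_lip_dominated (C := 1) _ cf cg) => // x y.
by rewrite mul1r max_dist.
Qed.

Lemma coarse_lip_min (f g : X -> R) :
  coarse_lip f -> coarse_lip g -> coarse_lip (fun x => Num.min (f x) (g x)).
Proof.
move=> cf cg; apply: (coarse_lip_dominated (C := 1) _ cf cg) => // x y.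
by rewrite mul1r min_dist.
Qed.

Lemma coarse_lipD {V : normedModType R} (f g : X -> V) :
  coarse_lip f -> coarse_lip g -> coarse_lip (fun x => f x + g x).
Proof.
move=> cf cg; apply: (coarse_lip_dominated (C := 1) _ cf cg) => // x y.
by rewrite mul1r opprD addrACA ler_normD.
Qed.

Lemma coarse_lipB {V : normedModType R} (f g : X -> V) :
  coarse_lip f -> coarse_lip g -> coarse_lip (fun x => f x - g x).
Proof.
move=> cf cg; apply: (coarse_lip_dominated (C := 1) _ cf cg) => // x y.
by rewrite mul1r opprD addrACA (le_trans (ler_normD _ _))// -opprD normrN.
Qed.

Lemma coarse_lip_cst {V : normedModType R} (c : V) : coarse_lip (fun _ : X =>
  c).
Proof.
apply: (coarse_lip_lipschitz (c := 0)) => // x y.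
by rewrite subrr normr0 mul0r.
Qed.

Lemma coarse_lip_mdist (a : X) : coarse_lip (mdist a : X -> R).
Proof.
apply: (coarse_lip_lipschitz (c := 1)) => // x y; rewrite mul1r.
have := metric_triangle a x y; have := metric_triangle a y x.
by rewrite (metric_sym y x) ler_norml => *; apply/andP; split; lra.
Qed.

End asymptotically_Lipschitz.

(** * Extension of real functions: Tietze and McShane *)

Section extension.
Context {R : realType}.

Lemma continuous_set_val {T : topologicalType} (A : set T) :
  continuous (set_val : A -> T).
Proof. exact: initial_continuous. Qed.

(** A filter on the subspace is pushed forward to the ambient space. A cluster point found there
    lies in [A], and it clusters the original filter because open sets of the subspace are traces of
    open sets. *)
Lemma compact_preimage_set_val {T : topologicalType} (A B : set T) :
  compact (A `&` B) -> compact (set_val @^-1` B : set A).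
Proof.
move=> cK F FF FB.
have FK : (set_val @ F) (A `&` B).
  by rewrite /fmap /=; apply: (@filterS _ F _ (set_val @^-1` B)) FB => z Bz;
    split=> //; exact: set_valP.
have /cK[z [[Az Bz] zF]] := FK; exists (SigSub (mem_set Az)); split=> // U V FU.
move=> [_ [[W oW <-] Wz WV]].
have nW : nbhs z W := open_nbhs_nbhs (conj oW Wz).
have FU' : (set_val @ F) (set_val @` U).
  by apply: (@filterS _ F _ U) FU => a Ua; exists a.
have [_ [[a Ua <-] Wa]] := zF _ _ FU' nW.
by exists a; split=> //; exact: WV.
Qed.

Lemma bounded_extension {T : topologicalType} (A : set T) (f : A -> R) (M : R) :
  normal_space T -> closed A -> 0 < M -> continuous f ->
  (forall a, `|f a| <= M) ->
  exists g : T -> R, [/\ continuous g, forall a, g (set_val a) = f a &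
    forall x, `|g x| <= M].
Proof.
(* [valL_] gives [f] the junk value 0 off [A]; continuity within [A] does not see it. *)
move=> nT clA M0 cf fM; pose h : T -> R := valL_ 0 f.
have hE (a : A) : h (set_val a) = f a.
  by have := congr1 (fun k => k a) (@valLK _ _ 0 A f).
have ch : {within A, continuous h} by apply/subspace_valL_continuousP'.
have hM x : A x -> `|h x| <= M.
  by move=> Ax; rewrite -[x]/(set_val (SigSub (mem_set Ax))) hE.
have [g [gh cg gM]] := continuous_bounded_extension nT clA M0 ch hM.
exists g; split=> // a; rewrite -hE; apply/esym/gh; exact: (valP a).
Qed.

(** [G x] is the infimum over [a] of [f a + c * d x (p a)]. The error [E] admits functions that are
    Lipschitz only up to a constant. The last clause, near attainment of the infimum, later yields
    properness of extended radial coordinates. *)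
Lemma mcshane_extension {T I : Type} (d : T -> T -> R) (p : I -> T) (f : I -> R)
    (c E : R) (a0 : I) : 0 <= c ->
  (forall x y, d x y = d y x) -> (forall x y z, d x z <= d x y + d y z) ->
  (forall a b, f a - f b <= c * d (p a) (p b) + E) ->
  exists G : T -> R, [/\ forall x y, `|G x - G y| <= c * d x y,
    forall x a, G x <= f a + c * d x (p a), forall a, f a - E <= G (p a) &
    forall x m, 0 < m -> exists a, f a + c * d x (p a) < G x + m].
Proof.
move=> c0 dC dD fE.
pose S x := [set f a + c * d x (p a) | a in [set: I]].
pose G x := inf (S x).
have hS x : has_inf (S x).
  split; first by exists (f a0 + c * d x (p a0)); exists a0.
  exists (f a0 - E - c * d x (p a0)) => _ [a _ <-]; have := fE a0 a.
  have := dD (p a0) x (p a); rewrite (dC (p a0) x) => /(ler_wpM2l c0); lra.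
have GS x a : G x <= f a + c * d x (p a).
  by apply: ge_inf; [case: (hS x)|exists a].
have GS' x b : (forall a, b <= f a + c * d x (p a)) -> b <= G x.
  by move=> H; apply: lb_le_inf => [|_ [a _ <-]//]; case: (hS x).
exists G; split=> [x y|//|a|x m m0].
- have H u v : G u - c * d u v <= G v.
    apply: GS' => a; have := GS u a; have := dD u v (p a) => /(ler_wpM2l c0);
      lra.
  have := H x y; have := H y x; rewrite (dC y x) ler_norml => *.
  by apply/andP; split; lra.
- by apply: GS' => b; have := fE a b; lra.
have [_ [a _ <-] h] := inf_adherent m0 (hS x); by exists a.
Qed.

(* McShane's formula gives a Lipschitz function that differs from [f] by a
   bounded error on [A]; Tietze's theorem removes the error. *)
Lemma coarse_lip_extension {X : metricType R} (A : set X) (f : A -> R) (a0 : A)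
  :
  closed A -> coarse_lip f ->
  exists2 F : X -> R, coarse_lip F /\ (forall a, F (set_val a) = f a) &
    exists2 c : R, 0 < c &
    forall x, exists a : A, f a + c * mdist x (set_val a) <= F x + 2 * c.
Proof.
move=> clA [cf [c0 c00 fc0]].
(* Adding 1 makes [c] positive, as Tietze's theorem requires of the bound on the error [f - G]. *)
pose c := c0 + 1; have cp : 0 < c by rewrite ltr_wpDl.
have fc a b : f a - f b <= c * mdist (set_val a) (set_val b) + c.
  apply: le_trans (ler_norm _) _; apply: le_trans (fc0 a b) _.
  have := mdist_ge0 (set_val a) (set_val b); rewrite /c mulrDl mul1r.
  by rewrite -[mdist a b]/(mdist (set_val a) (set_val b)) => ?; lra.
have [G [Glip GS Gge Gadh]] :=
  mcshane_extension a0 (ltW cp) (@metric_sym _ X) (@metric_triangle _ X) fc.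
have Gcl : coarse_lip G := coarse_lip_lipschitz (ltW cp) Glip.
have Gle a : G (set_val a) <= f a by have := GS (set_val a) a; rewrite mdistxx;
  lra.
have cGv : continuous (G \o set_val : A -> R).
  have [cG _] := Gcl => a; apply: continuous_comp; last exact: cG.
  exact: continuous_set_val.
have cE := continuous_subf cf cGv.
have [a|E [cE' EE EM]] := bounded_extension pseudometric_normal clA cp cE.
  by have := Gle a; have := Gge a => ? ? /=; rewrite ger0_norm; lra.
exists (fun x => G x + E x); first split.
- apply: coarse_lipD => //; split=> //; exists (2 * c); first by lra.
  move=> x y; apply: le_trans (ler_normB _ _) _.
  have := EM x; have := EM y; have := mdist_ge0 x y => h *.
  have : 0 <= c * mdist x y by rewrite mulr_ge0// ltW.
  lra.
- by move=> a; rewrite EE /= addrC subrK.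
(* One [c] is the slack in the infimum, the other the bound on [E]. The clause makes [F] grow with
   the distance from [A], which is what properness needs. *)
exists c => // x; have [a h] := Gadh x c cp.
by exists a; have := EM x; rewrite ler_norml => /andP[]; lra.
Qed.

End extension.

(** * Slowly oscillating maps into normed spaces *)

Section Higson_maps.
Context {R : realType} {X : metricType R}.
Variable x0 : X.

Definition proper_fun (t : X -> R) :=
  forall N, exists M, forall x, t x <= N -> mdist x0 x <= M.

(** Vector-valued form of membership in [higson_functions], with balls about [x0] in place of
    compact sets; in a proper space each kind of set is contained in one of the other. *)
Definition higson_map {V : normedModType R} (psi : X -> V) :=
  [/\ continuous psi, exists M, forall x, `|psi x| <= M &
    forall r e, 0 < e -> exists M, forall x y,
      M < mdist x0 x -> mdist x y < r -> `|psi x - psi y| < e].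

Lemma compact_mdist_bounded (K : set X) :
  compact K -> exists M, forall x, K x -> mdist x0 x <= M.
Proof.
move=> cK; have /compact_bounded[M [_ h]] : compact (mdist x0 @` K : set R).
  apply: continuous_compact cK; apply: continuous_subspaceT.
  exact: continuous_mdist.
exists (M + 1) => x Kx; apply: le_trans (ler_norm _) _.
by apply: (h (M + 1)); [rewrite ltrDl|exists x].
Qed.

Lemma proper_space_compact (K : set X) M : proper_space X ->
  closed K -> (forall x, K x -> mdist x0 x <= M) -> compact K.
Proof. by move=> pX cK KM; apply: (subclosed_compact cK (pX x0 M)). Qed.

Lemma higson_functionsP (phi : X -> R) : proper_space X ->
  higson_functions X phi <-> higson_map phi.
Proof.
move=> pX; split=> [[cphi bphi sphi]|[cphi [M bphi] sphi]]; split=> //.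
- by have [M [_ h]] := bphi; exists (M + 1) => x; apply: (h (M + 1));
  rewrite ?ltrDl.
- move=> r e e0; have [r0|r0] := ltP 0 r; last first.
    by exists 0 => x y _; rewrite ltNge (le_trans r0)// mdist_ge0.
  have [K [cK h]] := sphi r e r0 e0; have [M KM] := compact_mdist_bounded cK.
  exists M => x y xM xy; rewrite -lte_fin distrC; apply: le_lt_trans (h x _).
    by apply: ereal_sup_ubound; exists y.
  by move=> /KM; rewrite leNgt xM.
- by exists M; split; [exact: num_real|move=> N MN x _;
  exact: le_trans (bphi x) (ltW MN)].
(* Half of [e], because a supremum of values below a bound may attain it. *)
move=> r e r0 e0; have e20 : 0 < e / 2 by rewrite divr_gt0.
have [N hN] := sphi r _ e20; exists [set x | mdist x0 x <= N]; split;
  first exact: pX.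
move=> x /= /negP; rewrite -ltNge => Nx.
apply: (@le_lt_trans _ _ (e / 2)%:E); last by rewrite lte_fin; lra.
apply: ge_ereal_sup => _ [y xy <-]; rewrite lee_fin distrC ltW//; exact: hN.
Qed.

Lemma higson_dominated {V W U : normedModType R}
    (f : X -> V) (g : X -> W) (h : X -> U) (C : R) : 0 <= C ->
  higson_map f -> higson_map g -> (exists M, forall x, `|h x| <= M) ->
  (forall x y, `|h x - h y| <= C * (`|f x - f y| + `|g x - g y|)) ->
  higson_map h.
Proof.
move=> C0 [cf _ sf] [cg _ sg] bh H; split=> //.
  exact: continuous_dominated cf cg H.
move=> r e e0; have d0 : 0 < e / (2 * (C + 1)).
  by rewrite divr_gt0// mulr_gt0// ltr_wpDl.
have [M hM] := sf r _ d0; have [N hN] := sg r _ d0.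
exists (Num.max M N) => x y; rewrite gt_max => /andP[xM xN] xy.
apply: le_lt_trans (H x y) _.
apply: (@le_lt_trans _ _ ((C + 1) * (`|f x - f y| + `|g x - g y|))).
  by rewrite ler_wpM2r ?addr_ge0//; lra.
have -> : e = (C + 1) * (e / (2 * (C + 1)) + e / (2 * (C + 1))).
  by field; rewrite gt_eqF// ltr_wpDl.
have C1 : 0 < C + 1 by rewrite ltr_wpDl.
by rewrite ltr_pM2l// ltrD ?hM ?hN.
Qed.

Lemma higson_lip {V W : normedModType R} (f : X -> V) (h : V -> W) :
  lip h -> higson_map f -> higson_map (h \o f).
Proof.
move=> [C C0 hC] hf; apply: (higson_dominated C0 hf hf) => [|x y /=].
  have [_ [M fM] _] := hf; exists (`|h 0| + C * M) => x /=.
  have := hC (f x) 0; have := fM x => /(ler_wpM2l C0); rewrite subr0.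
  have := lerB_dist (h (f x)) (h 0); lra.
by apply: le_trans (hC _ _) _; rewrite ler_wpM2l// lerDl.
Qed.

Lemma higson_coord n (f : X -> 'rV[R]_n) i :
  higson_map f -> higson_map (fun x => f x ord0 i).
Proof.
move=> hf; apply: (higson_dominated (C := 1) _ hf hf) => // [|x y].
  by have [_ [M fM] _] := hf; exists M => x;
    exact: le_trans (row_coord_le _ _) _.
rewrite mul1r; have := row_coord_le (f x - f y) i; rewrite !mxE => h.
by apply: le_trans h _; rewrite lerDl.
Qed.

Lemma higson_row n (f : X -> 'rV[R]_n) :
  (forall i, higson_map (fun x => f x ord0 i)) -> higson_map f.
Proof.
move=> H; split; first by apply: continuous_row => i; case: (H i).
  have /choice[M hM] : forall i, exists M, forall x, `|f x ord0 i| <= M.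
    by move=> i; have [] := H i.
  exists (\sum_i `|M i|) => x; apply: row_norm_le => [|i];
    first exact: sumr_ge0.
  apply: le_trans (hM i x) _; rewrite (bigD1 i)//=.
  by apply: le_trans (ler_norm _) _; rewrite lerDl sumr_ge0.
move=> r e e0; have e20 : 0 < e / 2 by rewrite divr_gt0.
have /choice[M hM] : forall i, exists M, forall x y, M < mdist x0 x ->
    mdist x y < r -> `|f x ord0 i - f y ord0 i| < e / 2.
  by move=> i; have [_ _ s] := H i; exact: s.
exists (\sum_i `|M i|) => x y xM xy; apply: (@le_lt_trans _ _ (e / 2));
  last by lra.
apply: row_norm_le => [|i]; first exact: ltW.
rewrite !mxE ltW//; apply: hM xy; apply: le_lt_trans xM.
rewrite (bigD1 i)//=; apply: le_trans (ler_norm _) _.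
by rewrite lerDl sumr_ge0.
Qed.

Lemma higsonB {V : normedModType R} (f g : X -> V) :
  higson_map f -> higson_map g -> higson_map (fun x => f x - g x).
Proof.
move=> hf hg; apply: (higson_dominated (C := 1) _ hf hg) => // [|x y].
  have [_ [M fM] _] := hf; have [_ [N gN] _] := hg; exists (M + N) => x.
  by apply: le_trans (ler_normB _ _) _; rewrite lerD.
by rewrite mul1r opprD addrACA (le_trans (ler_normD _ _))// -opprD normrN.
Qed.

Lemma higsonD {V : normedModType R} (f g : X -> V) :
  higson_map f -> higson_map g -> higson_map (fun x => f x + g x).
Proof.
move=> hf hg; apply: (higson_dominated (C := 1) _ hf hg) => // [|x y].
  have [_ [M fM] _] := hf; have [_ [N gN] _] := hg; exists (M + N) => x.
  by apply: le_trans (ler_normD _ _) _; rewrite lerD.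
by rewrite mul1r opprD addrACA ler_normD.
Qed.

Lemma higsonZ {V : normedModType R} (f : X -> R) (g : X -> V) :
  higson_map f -> higson_map g -> higson_map (fun x => f x *: g x).
Proof.
move=> hf hg; have [_ [M fM] _] := hf; have [_ [N gN] _] := hg.
apply: (higson_dominated (C := `|M| + `|N|) _ hf hg) => // [|x y].
  exists (`|M| * `|N|) => x; rewrite normrZ ler_pM//.
    exact: le_trans (fM x) (ler_norm _).
  exact: le_trans (gN x) (ler_norm _).
apply: le_trans (scale_dist _ _ _ _) _.
have h1 : `|f x| <= `|M| + `|N| by have := fM x; have := ler_norm M;
  have := normr_ge0 N; lra.
have h2 : `|g y| <= `|M| + `|N| by have := gN y; have := ler_norm N;
  have := normr_ge0 M; lra.
by rewrite mulrDr addrC lerD ?ler_wpM2r// mulrC ler_wpM2r.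
Qed.

(** After multiplication by [t] the difference is [v - v'] plus [(1 - t / t') *: v'], and the second
    term has norm at most [|t - t'|] since [|v'| <= t']. The convention that 0 has inverse 0 covers
    vanishing radii. *)
Lemma radial_dist {V : normedModType R} (t t' : R) (v v' : V) :
  0 <= t -> `|v| <= t -> `|v'| <= t' ->
  t * `|t^-1 *: v - t'^-1 *: v'| <= `|v - v'| + `|t - t'|.
Proof.
move=> t0 vt vt'; have t'0 : 0 <= t' := le_trans (normr_ge0 _) vt'.
have [->|tn0] := eqVneq t 0; first by rewrite mul0r addr_ge0.
have tp : 0 < t by rewrite lt_neqAle eq_sym tn0.
rewrite -[X in X * _](ger0_norm t0) -normrZ scalerBr !scalerA divff// scale1r.
have [t'E|t'n0] := eqVneq t' 0.
  move: vt'; rewrite t'E normr_le0 => /eqP ->.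
  by rewrite scaler0 subr0 lerDl.
rewrite -[v in leLHS](subrK v') -addrA -{2}[v']scale1r -scalerBl.
apply: le_trans (ler_normD _ _) _; rewrite lerD2l normrZ.
have -> : 1 - t / t' = (t' - t) / t' by field.
rewrite normrM normfV (ger0_norm t'0) distrC -mulrA ler_piMr//.
by rewrite mulrC ler_pdivrMr ?mul1r// lt_neqAle eq_sym t'n0.
Qed.

(** By [radial_dist], the oscillation over distance [r] is at most a constant divided by [t], and
    [t] tends to infinity. The maximum with 1 avoids small denominators and changes nothing far
    out. *)
Lemma higson_quotient {V : normedModType R} (u : X -> V) (t : X -> R) :
  coarse_lip u -> coarse_lip t -> proper_fun t ->
  (forall x, `|u x| <= Num.max (t x) 1) ->
  higson_map (fun x => (Num.max (t x) 1)^-1 *: u x).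
Proof.
move=> cu ct pt ut; pose T x := Num.max (t x) 1.
have T1 x : 1 <= T x by rewrite le_max lexx orbT.
have T0 x : 0 < T x := lt_le_trans ltr01 (T1 x).
have cT : coarse_lip T by apply: coarse_lip_max => //; exact: coarse_lip_cst.
have H x y : T x * `|(T x)^-1 *: u x - (T y)^-1 *: u y| <=
  `|u x - u y| + `|T x - T y|.
  by apply: radial_dist => //; exact: ltW.
have [cu' [c c0 hc]] := cu; have [cT' [d d0 hd]] := cT; split.
- apply: (continuous_dominated (C := 1) cu' cT') => x y; rewrite mul1r.
  by apply: le_trans (H x y); rewrite ler_peMl.
- exists 1 => x; rewrite -/(T x) normrZ normfV (gtr0_norm (T0 x)).
  by rewrite mulrC ler_pdivrMr ?mul1r; [exact: ut|exact: T0].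
move=> r e e0; have [M hM] := pt ((c + d) * (1 + r) / e); exists M => x y xM xy.
have Tx : (c + d) * (1 + r) / e < T x.
  by rewrite lt_max ltNge; apply/orP; left; apply/negP => /hM; rewrite leNgt xM.
rewrite -(ltr_pM2l (T0 x)); apply: le_lt_trans (H x y) _.
move: Tx; rewrite ltr_pdivrMr// => Tx; apply: le_lt_trans Tx.
apply: le_trans (lerD (hc x y) (hd x y)) _; rewrite -mulrDl.
by rewrite ler_wpM2l ?addr_ge0//; lra.
Qed.

(* [s] is the largest 1-Lipschitz function with [s x0 <= 0] satisfying the
   last inequality. *)
Lemma higson_scale {V : normedModType R} (psi : X -> V) : higson_map psi ->
  exists s : X -> R, [/\ coarse_lip s, forall x, 0 <= s x, proper_fun s &
    forall x y, s x * `|psi x - psi y| <= 1 + mdist x y].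
Proof.
move=> [_ [M0 bpsi] spsi].
pose M := `|M0|; have M0' : 0 <= M := normr_ge0 _.
have {}bpsi x : `|psi x| <= M := le_trans (bpsi x) (ler_norm _).
(* [s] will be the infimum of the cones [mdist x y + c] over these pairs. The pair [(x0, 0)] makes
   the family nonempty; in the others, [c] bounds from above a value that [s y] may not exceed. *)
pose P y c := (y = x0 /\ c = 0) \/
  (0 <= c /\ exists z, 1 + mdist y z <= c * `|psi y - psi z|).
have P0 y c : P y c -> 0 <= c by move=> [[_ ->]|[]].
pose S x := [set m | exists y c, P y c /\ m = mdist x y + c].
have S0 x m : S x m -> 0 <= m.
  by move=> [y [c [/P0 c0 ->]]]; rewrite addr_ge0// mdist_ge0.
have hS x : has_inf (S x).
  split; last by exists 0 => m /S0.
  by exists (mdist x x0 + 0); exists x0, 0; split=> //; left.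
pose s x := inf (S x).
have s_le x y c : P y c -> s x <= mdist x y + c.
  by move=> Pyc; apply: ge_inf; [case: (hS x)|exists y, c].
have le_s x b : (forall y c, P y c -> b <= mdist x y + c) -> b <= s x.
  move=> H; apply: lb_le_inf; first by case: (hS x).
  by move=> _ [y [c [/H h ->]]].
have slip x y : `|s x - s y| <= 1 * mdist x y.
  have H u v : s u - mdist u v <= s v.
    apply: le_s => z c /(s_le u); have := metric_triangle u v z; lra.
  have := H x y; have := H y x; rewrite (metric_sym y x) ler_norml => *.
  by apply/andP; split; lra.
have s0 x : 0 <= s x.
  by apply: le_s => y c /P0 c0; rewrite addr_ge0// mdist_ge0.
exists s; split=> //; first exact: coarse_lip_lipschitz slip.
- move=> N; pose N1 := `|N| + 1; have N10 : 0 < N1 by rewrite ltr_wpDl.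
  (* If [s x < N1], some pair has [c < N1] and [y] within [N1] of [x]. A witness [z] then satisfies
     [1 + mdist y z <= N1 * |psi y - psi z|], so it lies within [2 * M * N1] of [y] while the
     oscillation is at least [1 / N1]. Slow oscillation confines such [y] to a ball. *)
  have [M' hM'] := spsi (2 * M * N1 + 1) N1^-1 ltac:(by rewrite invr_gt0).
  exists (`|M'| + N1) => x sx.
  have : s x < N1 by rewrite /N1; have := ler_norm N; lra.
  move=> /(inf_lt (proj1 (hS x)))[_ [y [c [Pyc ->]]] h].
  have xy : mdist x y < N1 by have := P0 _ _ Pyc; lra.
  case: Pyc => [[yE _]|[c0 [z hz]]].
    by rewrite metric_sym -yE; have := normr_ge0 M'; lra.
  have cN : c < N1 by have := mdist_ge0 x y; lra.
  have dM : `|psi y - psi z| <= 2 * M.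
    by apply: le_trans (ler_normB _ _) _; have := bpsi y; have := bpsi z; lra.
  have yM : mdist x0 y <= M'.
    rewrite leNgt; apply/negP => yM; have := hM' y z yM.
    have h1 : c * `|psi y - psi z| <= N1 * (2 * M).
      by rewrite ler_pM// ltW.
    have h2 : mdist y z < 2 * M * N1 + 1 by lra.
    move=> /(_ h2); have h3 : c * `|psi y - psi z| <= N1 * `|psi y - psi z|.
      by rewrite ler_wpM2r// ltW.
    rewrite -[N1^-1]mul1r ltr_pdivlMr// => h4.
    by have := mdist_ge0 y z; lra.
  have := metric_triangle x0 y x; rewrite (metric_sym y x).
  by have := ler_norm M'; lra.
move=> x y; have [->|n0] := eqVneq (`|psi x - psi y|) 0.
  by rewrite mulr0 addr_ge0 ?mdist_ge0.
have np : 0 < `|psi x - psi y| by rewrite lt_neqAle eq_sym n0 normr_ge0.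
rewrite -ler_pdivlMr//; have := s_le x x ((1 + mdist x y) / `|psi x - psi y|).
rewrite mdistxx add0r; apply; right; split.
  by rewrite divr_ge0// addr_ge0 ?mdist_ge0.
by exists y; rewrite divfK.
Qed.

End Higson_maps.

(** * Closed conditions and cluster points *)

Section topology.

Lemma cluster_closed {T : topologicalType} (F : set_system T) (S : set T) w :
  cluster F w -> closed S -> F S -> S w.
Proof. by move=> Fw cS FS; apply: cS => U /(Fw _ _ FS). Qed.

Lemma closed_norm_le {R : realType} {T : topologicalType} {V : normedModType R}
    (f : T -> V) (c : R) : continuous f -> closed [set x | `|f x| <= c].
Proof.
by move=> /continuous_normf/continuous_closedP/(_ _ (@closed_le R c)).
Qed.

End topology.

(** * Topology of the Higson corona *)

Section Higson_corona.
Context {R : realType} {X : metricType R}.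
Hypothesis X_proper : proper_space X.
Variable x0 : X.

Let hmap {V : normedModType R} := @higson_map R X x0 V.
Let corona := higson_corona X.
Let compactification := higson_compactification X.
Let emb : X -> higson_product X := @higson_embedding R X.

(* Points of the Higson compactification are functions on the set of Higson
   functions; off that set the value of [higson_eval] is junk. *)
Definition higson_eval (phi : X -> R) (z : higson_product X) : R :=
  if pselect (higson_functions X phi) is left h then z (SigSub (mem_set h)) else
    0.

Definition higson_eval_row n (psi : X -> 'rV[R]_n) (z : higson_product X)
  : 'rV[R]_n :=
  \row_i higson_eval (fun x => psi x ord0 i) z.

Lemma higson_eval_continuous phi : continuous (higson_eval phi).
Proof.
rewrite /higson_eval; case: pselect => h; last exact: cst_continuous.
exact: (@proj_continuous _ (fun _ : higson_functions X => R^o)).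
Qed.

Lemma higson_eval_row_continuous n (psi : X -> 'rV[R]_n) :
  continuous (higson_eval_row psi).
Proof.
apply: continuous_row => i; under eq_fun do rewrite mxE.
exact: higson_eval_continuous.
Qed.

Lemma higson_eval_val (phi : higson_functions X) z :
  higson_eval (set_val phi) z = z phi.
Proof.
rewrite /higson_eval; case: pselect => [h|]; last by case; exact: set_valP.
by congr (z _); apply: val_inj.
Qed.

Lemma higson_eval_embedding phi x : hmap phi -> higson_eval phi (emb x) = phi x.
Proof.
move=> /(higson_functionsP _ _ X_proper) h.
by rewrite -[phi]/(set_val (SigSub (mem_set h))) higson_eval_val.
Qed.

Lemma higson_eval_row_embedding n (psi : X -> 'rV[R]_n) x :
  hmap psi -> higson_eval_row psi (emb x) = psi x.
Proof.
move=> h; apply/rowP => i; rewrite mxE higson_eval_embedding//.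
exact: higson_coord.
Qed.

Lemma higson_hausdorff : hausdorff_space (higson_product X).
Proof. by apply: hausdorff_product => phi; exact: Rhausdorff. Qed.

Lemma higson_embedding_continuous : continuous emb.
Proof.
move=> x; apply/cvg_sup => phi; apply: continuous_comp_initial.
by have [] := set_valP phi.
Qed.

(** Each coordinate is bounded on the image of [X], so the closure lies in a product of compact
    intervals and Tychonoff's theorem applies. *)
Lemma compactification_compact : compact compactification.
Proof.
have /choice[M hM] : forall phi : higson_functions X, exists M,
    forall x, `|set_val phi x| <= M.
  move=> phi; have /(higson_functionsP x0 _ X_proper)[_ [M hM] _]
    := set_valP phi.
  by exists M.
pose B : set (higson_product X) :=
  [set z | forall phi, [set r : R^o | `|r| <= M phi] (z phi)].
have cB : compact B.
  apply: (@tychonoff (higson_functions X) (fun=> R^o) (fun phi =>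
    [set r : R^o | `|r| <= M phi])) => phi.
  have -> : [set r : R^o | `|r| <= M phi] = `[- M phi, M phi]%classic.
    by apply/seteqP; split=> r /=; rewrite in_itv/= ler_norml.
  exact: segment_compact.
apply: (subclosed_compact _ cB); first exact: closed_closure.
have := compact_closed higson_hausdorff cB => /closure_id ->.
by apply: closure_subset => _ [x _ <-] phi; exact: hM.
Qed.

(** The image of a ball is compact, hence closed. A corona point is in the closure of the whole
    image but not in the image of the ball, so it lies in every closed set containing the rest. *)
Lemma corona_sub_closed (S : set (higson_product X)) (M : R) : closed S ->
  (forall x, M < mdist x0 x -> S (emb x)) -> corona `<=` S.
Proof.
move=> cS H z [zX zN].
have cK : closed (emb @` [set x | mdist x0 x <= M]).
  apply: compact_closed; first exact: higson_hausdorff.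
  apply: continuous_compact; last exact: X_proper.
  apply: continuous_subspaceT.
  exact: higson_embedding_continuous.
have : closure (emb @` [set x | mdist x0 x <= M] `|` S) z.
  apply: closure_subset zX => _ [x _ <-].
  have [h|h] := leP (mdist x0 x) M; first by left; exists x.
  by right; exact: H.
rewrite -(proj1 (closure_id _)); last exact: closedU.
by case=> // -[x _ xz]; case: zN; exists x.
Qed.

(** The means by which identities valid far out in [X] are carried to the corona. *)
Lemma corona_eq {V : normedModType R} (F G : higson_product X -> V) (M : R) :
  continuous F -> continuous G ->
  (forall x, M < mdist x0 x -> F (emb x) = G (emb x)) ->
  forall z, corona z -> F z = G z.
Proof.
move=> cF cG H; have cFG := continuous_subf cF cG.
have := corona_sub_closed (M := M) (closed_norm_le (c := 0) cFG).
move=> h z /h /=; rewrite normr_le0 subr_eq0 => h'; apply/eqP/h' => x xM.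
by rewrite /= H// subrr normr0.
Qed.

(** A Higson function that is 1 on the ball of radius [M] and vanishes on the corona; it separates
    the corona from the points of [X]. *)
Definition bump (M : R) (x : X) : R
  := Num.max 0 (Num.min 1 (M + 1 - mdist x0 x)).

Lemma bump_higson M : hmap (bump M).
Proof.
have clip x y : `|bump M x - bump M y| <= 1 * mdist x y.
  rewrite mul1r; apply: le_trans (max_dist _ _ _ _) _;
    rewrite subrr normr0 add0r.
  apply: le_trans (min_dist _ _ _ _) _; rewrite subrr normr0 add0r.
  have := metric_triangle x0 x y; have := metric_triangle x0 y x.
  by rewrite (metric_sym y x) ler_norml => *; apply/andP; split; lra.
have b0 x : 0 <= bump M x by rewrite le_max lexx.
have [cb _] := coarse_lip_lipschitz ler01 clip.
split=> //.
  exists 1 => x; rewrite ger0_norm// /bump.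
  by rewrite ge_max ler01 ge_min lexx.
move=> r e e0; exists (M + 1 + r) => x y xM xy.
have := metric_triangle x0 y x; rewrite (metric_sym y x) => xyx.
have [r0|r0] := ltP r 0; first by have := mdist_ge0 x y; lra.
have -> : bump M x = 0 by apply: max_l; rewrite ge_min; apply/orP; right; lra.
have -> : bump M y = 0 by apply: max_l; rewrite ge_min; apply/orP; right; lra.
by rewrite subrr normr0.
Qed.

Lemma bump1 M x : mdist x0 x <= M -> bump M x = 1.
Proof. by move=> xM; rewrite /bump min_l ?max_r//; lra. Qed.

Lemma bump0 M x : M + 1 <= mdist x0 x -> bump M x = 0.
Proof. by move=> xM; apply: max_l; rewrite ge_min; apply/orP; right; lra. Qed.

Lemma corona_bump M z : corona z -> higson_eval (bump M) z = 0.
Proof.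
apply: (corona_eq (F := higson_eval (bump M)) (G := fun=> 0) (M := M + 1)).
- exact: higson_eval_continuous.
- by move=> x; exact: cst_continuous.
move=> x xM; rewrite higson_eval_embedding ?bump0//; last exact: bump_higson.
exact: ltW.
Qed.

(** Inside the compactification, the corona is the common zero set of all bumps: at the image of [x]
    the bump of radius [mdist x0 x] equals 1. *)
Lemma corona_closed : closed corona.
Proof.
have -> : corona = compactification `&`
    \bigcap_(M in [set: R]) [set z | `|higson_eval (bump M) z| <= 0].
  apply/seteqP; split=> z.
    move=> zc; split; first by case: zc.
    by move=> M _ /=; rewrite corona_bump// normr0.
  move=> [zc zb]; split=> // -[x _ xz]; have := zb (mdist x0 x) I;
    rewrite /= -xz.
  by rewrite higson_eval_embedding ?bump1 ?normr1 ?ler10//; exact: bump_higson.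
apply: closedI; first exact: closed_closure.
by apply: closed_bigI => M _; apply: closed_norm_le;
  exact: higson_eval_continuous.
Qed.

(** Otherwise points outside [O] go to infinity and cluster at a point of the compactification
    outside [O], hence at the image of some [x]. The bump that is 1 at [x] eventually vanishes along
    them, a contradiction. *)
Lemma corona_nbhs (O : set (higson_product X)) : open O -> corona `<=` O ->
  exists M, forall x, M < mdist x0 x -> O (emb x).
Proof.
move=> oO sO; apply: contrapT => /forallNP H.
have {}H M : exists x, M < mdist x0 x /\ ~ O (emb x).
  by have /existsNP[x /not_implyP h] := H M; exists x.
have /choice[f hf] := H.
pose F : set_system (higson_product X) := (emb \o f) @ +oo.
have FF : ProperFilter F by apply: fmap_proper_filter.
have FX : \forall M \near +oo, compactification (emb (f M)).
  by apply: nearW => M; apply: subset_closure; exists (f M).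
have [z [zX zc]] := compactification_compact FF FX.
have zO : ~ O z.
  apply: (cluster_closed (S := ~` O) zc); first exact: open_closedC.
  have : \forall M \near +oo, ~ O (emb (f M)) by apply: nearW => M;
    case: (hf M).
  by [].
apply: zO; apply: sO; split=> // -[x _ xz].
have : `|higson_eval (bump (mdist x0 x)) z| <= 0.
  apply: (cluster_closed (S := [set z | `|higson_eval (bump (mdist x0 x)) z| <=
    0]) zc).
    by apply: closed_norm_le; exact: higson_eval_continuous.
  suff : \forall M \near +oo,
    `|higson_eval (bump (mdist x0 x)) (emb (f M))| <= 0 by [].
  near=> M; rewrite higson_eval_embedding ?bump0 ?normr0//;
    last exact: bump_higson.
  by apply: ltW; apply: lt_trans (proj1 (hf M)); near: M; apply: nbhs_pinfty_gt;
    exact: num_real.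
rewrite -xz higson_eval_embedding ?bump1 ?normr1 ?ler10//; exact: bump_higson.
Unshelve. all: by end_near. Qed.

End Higson_corona.

(** * Continuous functions on the Higson compactification *)

Section continuous_on_compactification.
Context {R : realType} {X : metricType R}.
Hypothesis X_proper : proper_space X.
Variable x0 : X.

Let T : topologicalType := set_type (higson_compactification X).
Let embT (x : X) : T :=
  SigSub (mem_set (subset_closure (ex_intro2 _ _ x I erefl))).

Lemma compactification_hausdorff : hausdorff_space T.
Proof.
move=> p q pq; apply: val_inj; apply: higson_hausdorff => A B pA qB.
have pA' : nbhs p (set_val @^-1` A) := continuous_set_val pA.
have qB' : nbhs q (set_val @^-1` B) := continuous_set_val qB.
by have [z []] := pq _ _ pA' qB'; exists (set_val z).
Qed.

Lemma compactificationT_compact : compact [set: T].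
Proof.
have := compactification_compact X_proper x0.
by rewrite -[higson_compactification X]setIT => /compact_preimage_set_val;
  rewrite preimage_setT.
Qed.

Lemma embT_continuous : continuous embT.
Proof. by apply: continuous_comp_initial;
  exact: higson_embedding_continuous. Qed.

Lemma embT_dense (E : set T) : closed E -> (forall x, E (embT x)) -> forall z,
  E z.
Proof.
move=> cE H z; apply: cE => U [_ [[W oW <-] Wz WU]].
have [_ [[x _ <-] Wx]] := set_valP z W (open_nbhs_nbhs (conj oW Wz)).
by exists (embT x); split=> //; exact: WU.
Qed.

(** If slow oscillation fails, pairs at distance below [r] go to infinity while [Psi] differs by at
    least [e] on each. By compactness the pairs cluster at some [(p, q)]. Every Higson function
    oscillates arbitrarily little along them, so [p] and [q] have the same coordinates, which
    contradicts the gap in [Psi]. *)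
Lemma higson_restriction (Psi : T -> R) (M : R) :
  continuous Psi -> (forall z, `|Psi z| <= M) -> higson_map x0 (Psi \o embT).
Proof.
move=> cPsi PsiM; split; last 1 first.
- move=> r e e0; apply: contrapT => /forallNP H.
  have /choice[f hf] : forall N, exists xy : X * X, [/\ N < mdist x0 xy.1,
      mdist xy.1 xy.2 < r & e <= `|Psi (embT xy.1) - Psi (embT xy.2)|].
    move=> N; have /existsNP[x /existsNP[y]] := H N.
    move=> /not_implyP[Nx /not_implyP[xy /negP]]; rewrite -leNgt => h.
    by exists (x, y).
  pose g N : T * T := (embT (f N).1, embT (f N).2).
  pose F : set_system (T * T)%type := g @ +oo.
  have FF : ProperFilter F by apply: fmap_proper_filter.
  have cTT : compact [set: T * T].
    by rewrite -setXTT; exact: compact_setX compactificationT_compact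
      compactificationT_compact.
  have [[p q] [_ pq]] := cTT F FF filterT.
  have cfst : continuous (fst : T * T -> T) by move=> ?; exact: cvg_fst.
  have csnd : continuous (snd : T * T -> T) by move=> ?; exact: cvg_snd.
  have cdiff (k : T -> R) : continuous k -> continuous (fun w : T * T =>
    k w.1 - k w.2).
    move=> ck; have c1 : continuous (k \o fst : T * T -> R).
      by move=> w; apply: continuous_comp; [exact: cfst|exact: ck].
    have c2 : continuous (k \o snd : T * T -> R).
      by move=> w; apply: continuous_comp; [exact: csnd|exact: ck].
    exact: continuous_subf c1 c2.
  have pqE : p = q.
    apply: val_inj; apply/functional_extensionality_dep => phi.
    have hphi : higson_map x0 (set_val phi).
      by apply/higson_functionsP => //; exact: set_valP.
    have ck : continuous (higson_eval (set_val phi) \o set_val : T -> R).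
      move=> w; apply: continuous_comp; first exact: continuous_set_val.
      exact: higson_eval_continuous.
    apply/eqP; rewrite -subr_eq0 -normr_le0; apply/ler_addgt0Pl => d d0.
    rewrite addr0; have := cluster_closed pq (closed_norm_le (c
      := d) (cdiff _ ck)).
    rewrite /= !higson_eval_val; apply.
    have [_ _ /(_ r d d0)[N hN]] := hphi.
    suff : \forall K \near +oo, `|higson_eval (set_val phi) (set_val (g K).1) -
        higson_eval (set_val phi) (set_val (g K).2)| <= d by [].
    near=> K; have [Kf fr _] := hf K.
    rewrite !(higson_eval_embedding X_proper _ hphi) ltW//; apply: hN fr.
    by apply: lt_trans Kf; near: K; apply: nbhs_pinfty_gt; exact: num_real.
  have cE : closed [set w : T * T | e <= `|Psi w.1 - Psi w.2|].
    have /continuous_normf/continuous_closedP := cdiff _ cPsi.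
    by move=> /(_ _ (@closed_ge R e)).
  have : e <= `|Psi p - Psi q|.
    apply: (cluster_closed pq cE).
    suff : \forall K \near +oo, e <= `|Psi (g K).1 - Psi (g K).2| by [].
    by apply: nearW => K; case: (hf K).
  by rewrite pqE subrr normr0 leNgt e0.
- by move=> x; apply: continuous_comp; [exact: embT_continuous|exact: cPsi].
- by exists M => x; exact: PsiM.
Unshelve. all: by end_near. Qed.

(* By compactness of the Higson compactification, Tietze's theorem extends
   [f] to all of it. *)
Lemma corona_extension (C : set (higson_corona X)) (f : C -> R) (M : R) :
  closed C -> continuous f -> 0 < M -> (forall c, `|f c| <= M) ->
  exists2 psi : X -> R, higson_map x0 psi &
    forall c : C, higson_eval psi (set_val (set_val c)) = f c.
Proof.
move=> clC cf M0 fM.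
(* [C'] is [C] seen inside the compactification; it is closed there because the corona is. *)
pose C' : set T := [set z | exists c : C, set_val (set_val c) = set_val z].
have clC' : closed C'.
  move: (closed_openC clC) => [W oW WE].
  have -> : C' = [set z : T | higson_corona X (set_val z)] `&` [set z
    : T | ~ W (set_val z)].
    apply/seteqP; split=> z.
      move=> [c cz]; split; rewrite /= -cz; first exact: set_valP.
      have : C (set_val c) := set_valP c.
      by move=> Cc Wc; have : (~` C) (set_val c) by rewrite -WE.
    move=> [/= zc zW]; pose w : higson_corona X := SigSub (mem_set zc).
    have Cw : C w.
      by apply: contrapT => Cw; have : (~` C) w := Cw; rewrite -WE.
    by exists (SigSub (mem_set Cw)).
  have /continuous_closedP cv
    := @continuous_set_val _ (higson_compactification X).
  apply: closedI; first exact: (cv _ (corona_closed X_proper x0)).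
  exact: (cv _ (open_closedC oW)).
have /choice[g hg] : forall a : C', exists c : C,
  set_val (set_val c) = set_val (set_val a).
  by move=> a; have [c hc] := set_valP a; exists c.
have cg : continuous g.
  apply: continuous_comp_initial; apply: continuous_comp_initial.
  have -> : set_val \o (set_val \o g) = set_val \o set_val
    :> (C' -> higson_product X).
    by apply/funext => a; exact: hg.
  by move=> a; apply: continuous_comp; exact: continuous_set_val.
have nT : normal_space T.
  exact: compact_normal compactification_hausdorff compactificationT_compact.
have cfg : continuous (f \o g).
  by move=> a; apply: continuous_comp; [exact: cg|exact: cf].
have [Psi [cPsi PsiE PsiM]] := bounded_extension nT clC' M0 cfg (fun a =>
  fM (g a)).
have hPsi := higson_restriction cPsi PsiM.
exists (Psi \o embT) => // c.
have cT : higson_compactification X (set_val (set_val c))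
  by case: (set_valP (set_val c)).
have cC' : C' (SigSub (mem_set cT)) by exists c.
have cev : continuous (higson_eval (Psi \o embT) \o set_val : T -> R).
  move=> w; apply: continuous_comp; first exact: continuous_set_val.
  exact: higson_eval_continuous.
have cd := continuous_subf cev cPsi.
(* Evaluation at the restriction of [Psi] is [Psi] itself: the two agree on the dense image of
   [X]. *)
have := embT_dense (closed_norm_le (c := 0) cd) _ (SigSub (mem_set cT)).
rewrite /= normr_le0 subr_eq0 => /(_ _)/eqP ->.
  have := PsiE (SigSub (mem_set cC'));
    rewrite -[set_val _]/(SigSub (mem_set cT)) => ->.
  by rewrite /=; congr f; do 2 apply: val_inj; exact: hg.
by move=> x /=; rewrite (higson_eval_embedding X_proper _ hPsi) subrr normr0.
Qed.

End continuous_on_compactification.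

(* [em_defect v t] is the distance from [v] to [t *: L] in units of the radius
   of a neighborhood of [L] on which the retraction is defined. *)
Record euclidean_model {R : realType} (L : metricType R) := EuclideanModel {
  em_dim : nat;
  em_map : L -> 'rV[R]_em_dim;
  em_lower : exists2 a : R, 0 < a &
    forall x y, a * mdist x y <= `|em_map x - em_map y|;
  em_upper : exists2 b : R, 0 <= b &
    forall x y, `|em_map x - em_map y| <= b * mdist x y;
  em_map_le1 : forall x, `|em_map x| <= 1;
  em_retr : 'rV[R]_em_dim -> 'rV[R]_em_dim;
  em_retr_lip : lip em_retr;
  em_retr_le1 : forall v, `|em_retr v| <= 1;
  em_retrK : forall x, em_retr (em_map x) = em_map x;
  em_defect : 'rV[R]_em_dim -> R -> R;
  em_defect_ge0 : forall v t, 0 <= em_defect v t;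
  em_defect_lip : exists2 c : R, 0 <= c & forall v w t u,
    `|em_defect v t - em_defect w u| <= c * (`|v - w| + `|t - u|);
  em_defect_map : forall x t, em_defect (t *: em_map x) t = 0;
  em_defect_scale : forall v t, 0 < t ->
    t * em_defect (t^-1 *: v) 1 <= em_defect v t;
  em_retr_defect : forall v, em_defect v 1 < 1 -> exists x, em_retr v = em_map x
}.

(** * Construction of the Euclidean model of a compact ALNER *)

Section model_of_ALNER.
Context {R : realType} {L : metricType R}.

(** Applied coordinatewise, a 1-Lipschitz retraction of Euclidean space onto the cube; it also
    serves as a cutoff profile later. *)
Definition clamp (r : R) : R := Num.max 0 (Num.min 1 r).

Lemma clamp_dist r s : `|clamp r - clamp s| <= `|r - s|.
Proof.
apply: le_trans (max_dist _ _ _ _) _; rewrite subrr normr0 add0r.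
by apply: le_trans (min_dist _ _ _ _) _; rewrite subrr normr0 add0r.
Qed.

Lemma clamp_itv r : 0 <= clamp r <= 1.
Proof. by rewrite le_max lexx ge_max ler01 ge_min lexx. Qed.

Lemma clamp_id r : 0 <= r <= 1 -> clamp r = r.
Proof. by move=> /andP[r0 r1]; rewrite /clamp min_r ?max_r. Qed.

Definition clampv n (v : 'rV[R]_n) : 'rV[R]_n := \row_i clamp (v ord0 i).

Lemma clampv_dist n (v w : 'rV[R]_n) : `|clampv v - clampv w| <= `|v - w|.
Proof.
apply: row_norm_le => // i; rewrite !mxE; apply: le_trans (clamp_dist _ _) _.
by have := row_coord_le (v - w) i; rewrite !mxE.
Qed.

Lemma clampv_cube n (v : 'rV[R]_n) : cube R n (clampv v).
Proof. by move=> i; rewrite mxE clamp_itv. Qed.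

Lemma clampv_id n (v : 'rV[R]_n) : cube R n v -> clampv v = v.
Proof. by move=> h; apply/rowP => i; rewrite mxE clamp_id. Qed.

Lemma cube_norm n (v : 'rV[R]_n) : cube R n v -> `|v| <= 1.
Proof.
move=> h; apply: row_norm_le => // i; have /andP[? ?] := h i.
by rewrite ger0_norm.
Qed.

(** Near each [x] half the radius of a ball inside [W] works for all nearby points; compactness, in
    its near-covering form along [eta] tending to 0 from the right, makes the choice uniform. *)
Lemma uniform_neighborhood n (e : L -> 'rV[R]_n) (W : set 'rV[R]_n) :
  compact [set: L] -> continuous e -> open W -> range e `<=` W ->
  exists2 eta : R, 0 < eta & forall x v, `|v - e x| < eta -> W v.
Proof.
move=> cL ce oW eW; move/compact_near_coveringP : cL.
move=> /(_ _ (0^'+ : set_system R) (fun eta x =>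
  forall v, `|v - e x| < eta -> W v) _).
case.
  move=> x _; have Wx : W (e x) by apply: eW; exists x.
  have /nbhs_ballP[d /= d0 dW] := open_nbhs_nbhs (conj oW Wx).
  have d20 : 0 < d / 2 by rewrite divr_gt0.
  have /cvgrPdist_lt/(_ _ d20) hx := ce x.
  exists ([set y | `|e x - e y| < d / 2], [set eta | eta < d / 2]) => /=.
    by split=> //; exact: nbhs_right_lt.
  move=> [y eta] [/= h1 h2] v h3; apply: dW; rewrite -ball_normE /=.
  rewrite -(subrK (e y) (e x)) -addrA; apply: le_lt_trans (ler_normD _ _) _.
  by rewrite (distrC (e y) v); lra.
move=> eta /= eta0 H; exists (eta / 2); first by rewrite divr_gt0.
move=> x v; apply: H => //=; last by rewrite divr_gt0.
by rewrite sub0r normrN gtr0_norm ?divr_gt0// ltr_pdivrMr// ltr_pMr// ltr1n.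
Qed.

(** Precomposition with [clampv] moves the domain of the retraction from the cube to a full
    Euclidean neighborhood of [e(L)]. McShane's formula extends each coordinate to the whole space,
    and a last [clampv] brings the values back to the cube. *)
Lemma alner_model : [set: L] !=set0 -> compact_ALNER L ->
  exists M : euclidean_model L, True.
Proof.
move=> [l0 _] [cL [n [e [U [r [[a [b [a0 b0 eab]]] ecube
  [Ucube [W [oW eW WU]]] rlip [rU re]]]]]]].
have eu x y : `|e x - e y| <= b * mdist x y by case/andP: (eab x y).
have [ce _] := coarse_lip_lipschitz (ltW b0) eu.
have [eta eta0 etaW] := uniform_neighborhood cL ce oW eW.
have [K K0 rK] : exists2 K : R, 0 <= K &
    forall u v, U u -> U v -> `|r u - r v| <= K * `|u - v|.
  have [K [Kr HK]] := rlip; exists (`|K| + 1); first by rewrite addr_ge0.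
  move=> u v Uu Uv; apply: (HK (`|K| + 1) _ (u, v)) => //=.
  by rewrite (le_lt_trans (ler_norm _))// ltrDl.
(* The [eta]-neighborhood of [e(L)], as the index type for McShane's formula with error 0. *)
pose N := {v : 'rV[R]_n | exists x, `|v - e x| < eta}.
have NU (v : N) : U (clampv (sval v)).
  apply: WU; split; last exact: clampv_cube.
  case: v => v /= [x vx]; apply: (etaW x); apply: le_lt_trans vx.
  by rewrite -[e x in leLHS]clampv_id ?clampv_dist//; apply: ecube; exists x.
have Nl x : exists y, `|e x - e y| < eta by exists x; rewrite subrr normr0.
have rE v : U v -> exists x, r v = e x.
  by move=> Uv; have [x _ <-] := rU (r v) (imageP _ Uv); exists x.
have /choice[G hG] : forall i : 'I_n, exists G : 'rV[R]_n -> R,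
    (forall v w, `|G v - G w| <= K * `|v - w|) /\
    (forall v : N, G (sval v) = r (clampv (sval v)) ord0 i).
  move=> i; pose f (v : N) := r (clampv (sval v)) ord0 i.
  have fK v w : f v - f w <= K * `|sval v - sval w| + 0.
    rewrite addr0; apply: le_trans (ler_norm _) _.
    have := row_coord_le (r (clampv (sval v)) - r (clampv (sval w))) i.
    rewrite !mxE => /le_trans; apply; apply: le_trans (rK _ _ (NU v) (NU w)) _.
    by rewrite ler_wpM2l// clampv_dist.
  have [||G [Glip GS Gge _]] := @mcshane_extension R 'rV[R]_n N
    (fun v w => `|v - w|) sval f K 0 (exist _ (e l0) (Nl l0)) K0 _ _ fK.
  - exact: distrC.
  - by move=> u v w; rewrite -{1}(subrK v u) -addrA ler_normD.
  exists G; split=> // v; apply/eqP; rewrite eq_le; apply/andP; split.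
    by have := GS (sval v) v; rewrite subrr normr0 mulr0 addr0.
  by have := Gge v; rewrite subr0.
pose r' v : 'rV[R]_n := clampv (\row_i G i v).
have r'N (v : N) : r' (sval v) = r (clampv (sval v)).
  rewrite /r'; have -> : \row_i G i (sval v) = r (clampv (sval v)).
    by apply/rowP => i; rewrite mxE; case: (hG i).
  by apply: clampv_id; have [x ->] := rE _ (NU v); apply: ecube; exists x.
pose D v t := inf [set `|v - t *: e x| / eta | x in [set: L]].
have D0 v t : lbound [set `|v - t *: e x| / eta | x in [set: L]] 0.
  by move=> _ [x _ <-]; rewrite divr_ge0// ltW.
have Dinf v t : has_inf [set `|v - t *: e x| / eta | x in [set: L]].
  by split; [exists (`|v - t *: e l0| / eta); exists l0|exists 0; exact: D0].
have D_le v t x : D v t <= `|v - t *: e x| / eta.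
  by apply: ge_inf; [case: (Dinf v t)|exists x].
have le_D v t c : (forall x, c <= `|v - t *: e x| / eta) -> c <= D v t.
  by move=> H; apply: lb_le_inf => [|_ [x _ <-]//]; case: (Dinf v t).
have e1 x : `|e x| <= 1 by apply: cube_norm; apply: ecube; exists x.
unshelve eexists (@EuclideanModel R L n e _ _ e1 r' _ _ _ D _ _ _ _ _) => //.
- by exists a => // x y; case/andP: (eab x y).
- by exists b => //; exact: ltW.
- exists K => // v w; apply: le_trans (clampv_dist _ _) _.
  apply: row_norm_le => [|i]; first by rewrite mulr_ge0.
  by rewrite !mxE; case: (hG i).
- by move=> v; apply: cube_norm; exact: clampv_cube.
- move=> x; rewrite (r'N (exist _ (e x) (Nl x))) /= clampv_id;
  last by apply: ecube; exists x.
  by apply: re; exists x.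
- by move=> v t; apply: le_D => x; rewrite divr_ge0// ltW.
- exists eta^-1; first by rewrite invr_ge0 ltW.
  (* Each function under the infimum is Lipschitz in [(v, t)] with constant [eta^-1], because
     [|e x| <= 1]. *)
  have H v w t u : D v t - eta^-1 * (`|v - w| + `|t - u|) <= D w u.
    apply: le_D => x; have := D_le v t x.
    have : `|v - t *: e x| <= `|v - w| + `|t - u| + `|w - u *: e x|.
      have -> : v - t *: e x = (v - w) + (u - t) *: e x + (w - u *: e x).
        rewrite scalerBl -!addrA; congr (_ + _).
        by rewrite !addrA [_ + w]addrC; rewrite -!addrA addrCA addKr; 
           rewrite addrCA subrr addr0.
      apply: le_trans (ler_normD _ _) _; rewrite lerD2r.
      apply: le_trans (ler_normD _ _) _; rewrite lerD2l normrZ distrC.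
      by rewrite ler_piMr.
    have i0 : 0 <= eta^-1 by rewrite invr_ge0 ltW.
    move=> /(ler_wpM2r i0); lra.
  move=> v w t u; have := H v w t u; have := H w v u t.
  rewrite (distrC w v) (distrC u t) ler_norml => *; apply/andP; split; lra.
- move=> x t; apply/eqP; rewrite eq_le; apply/andP; split; last first.
    by apply: le_D => y; rewrite divr_ge0// ltW.
  by apply: le_trans (D_le _ _ x) _; rewrite subrr normr0 mul0r.
- move=> v t t0; apply: le_D => x; have := D_le (t^-1 *: v) 1 x.
  move=> /(ler_wpM2l (ltW t0)) /le_trans; apply.
  rewrite mulrA ler_wpM2r ?invr_ge0 ?(ltW eta0)//.
  rewrite -[X in X * _](gtr0_norm t0) -normrZ scalerBr scalerA divff ?gt_eqF//.
  by rewrite !scale1r.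
(* Defect below 1 puts [v] within [eta] of [e(L)], where the extended map is still the original
   retraction after [clampv]. *)
- move=> v /(inf_lt (proj1 (Dinf v 1)))[_ [x _ <-]].
  rewrite scale1r ltr_pdivrMr// mul1r => vx;
    have Nv : exists x, `|v - e x| < eta by exists x.
  by rewrite (r'N (exist _ v Nv)); exact: rE (NU (exist _ v Nv)).
Qed.

End model_of_ALNER.

(** * Euclidean coordinates on the open cone *)

Section maps_into_the_cone.
Context {R : realType} {L : metricType R}.
Variables (M : euclidean_model L) (hL : diameter_le1 L).
Hypothesis cL : compact [set: L].

Let e := @em_map R L M.

(** A relation, so that no representative [(x, t)] has to be chosen; the lemmas below show that it
    is the graph of an injective function. *)
Definition cone_coord (p : open_cone hL) (v : 'rV[R]_(em_dim M)) (r : R) :=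
  exists (x : L) (t : {nonneg R}), [/\ p = cone_pt hL x t,
    r = t%:num & v = r *: e x].

Lemma cone_coord_ge0 p v r : cone_coord p v r -> 0 <= r.
Proof. by move=> [x [t [_ -> _]]]. Qed.

Lemma cone_coord_norm p v r : cone_coord p v r -> `|v| <= r.
Proof.
move=> h; have r0 := cone_coord_ge0 h; case: h => x [t [_ _ ->]].
by rewrite normrZ ger0_norm// ler_piMr// em_map_le1.
Qed.

Lemma cone_coord_pt (x : L) (r : R) (r0 : 0 <= r) :
  cone_coord (cone_pt hL x (NngNum r0)) (r *: e x) r.
Proof. by exists x, (NngNum r0). Qed.

Lemma cone_coord_ex p : exists v r, cone_coord p v r.
Proof.
exists ((repr p).2%:num *: e (repr p).1), (repr p).2%:num, (repr p).1,
  (repr p).2.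
by split=> //; rewrite /cone_pt -surjective_pairing reprK.
Qed.

(** Both distances are compared with [min t u * |e x - e y|], which differs from
    [|t *: e x - u *: e y|] by at most [|t - u|] since [e] has norm at most 1. *)
Lemma cone_coord_dist : exists2 C : R, 0 < C &
  forall p q v w r s, cone_coord p v r -> cone_coord q w s ->
    `|v - w| + `|r - s| <= C * mdist p q /\
    mdist p q <= C * (`|v - w| + `|r - s|).
Proof.
have [a a0 ha] := em_lower M; have [b b0 hb] := em_upper M.
exists (b + 2 + 2 * a^-1); first
  by rewrite ltr_wpDr ?mulr_ge0 ?invr_ge0 ?ltW// ltr_wpDl.
have ai : 0 < a^-1 by rewrite invr_gt0.
move=> _ _ _ _ _ _ [x [t [-> -> ->]]] [y [u [-> -> ->]]]; rewrite mdist_coneE.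
have t0 : 0 <= t%:num by []. have u0 : 0 <= u%:num by [].
move: t%:num u%:num t0 u0 => {}t {}u t0 u0.
have m0 : 0 <= Num.min t u by rewrite le_min t0 u0.
have d0 := mdist_ge0 x y; have n0 := normr_ge0 (t - u).
have {}ha : Num.min t u * mdist x y <= a^-1 * (Num.min t u * `|e x - e y|).
  by rewrite mulrCA ler_wpM2l// mulrC ler_pdivlMr// mulrC.
have {}hb : Num.min t u * `|e x - e y| <= b * (Num.min t u * mdist x y).
  by rewrite mulrCA ler_wpM2l.
have up : `|t *: e x - u *: e y| <= Num.min t u * `|e x - e y| + `|t - u|.
  have [tu|/ltW ut] := leP t u.
    apply: le_trans (scale_dist _ _ _ _) _; rewrite (ger0_norm t0) lerD2l.
    by rewrite ler_piMr// em_map_le1.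
  rewrite distrC; apply: le_trans (scale_dist _ _ _ _) _.
  rewrite (ger0_norm u0) (distrC (e y)) (distrC u t) lerD2l.
  by rewrite ler_piMr// em_map_le1.
have lo : Num.min t u * `|e x - e y| <= `|t *: e x - u *: e y| + `|t - u|.
  have [tu|/ltW ut] := leP t u.
    rewrite -{1}(ger0_norm t0) -normrZ.
    have -> : t *: (e x - e y) = (t *: e x - u *: e y) + (u - t) *: e y.
      by rewrite scalerBr scalerBl addrA subrK.
    apply: le_trans (ler_normD _ _) _; rewrite lerD2l normrZ distrC.
    by rewrite ler_piMr// em_map_le1.
  rewrite -{1}(ger0_norm u0) -normrZ.
  have -> : u *: (e x - e y) = (t *: e x - u *: e y) + (u - t) *: e x.
    by apply/rowP => i; rewrite !mxE; ring.
  apply: le_trans (ler_normD _ _) _; rewrite lerD2l normrZ distrC.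
  by rewrite ler_piMr// em_map_le1.
move: (Num.min t u * mdist x y) (Num.min t u * `|e x - e y|) (mulr_ge0 m0 d0) ha
  hb up lo.
move: `|t - u| n0 `|t *: e x - u *: e y| (normr_ge0 (t *: e x - u *: e y)).
move: a^-1 ai => c c0 n n0 N N0 m k m1 h1 h2 h3 h4.
have k0 : c * k <= c * (N + n) by rewrite ler_wpM2l// ltW.
have h5 : 0 <= c * N by rewrite mulr_ge0// ltW.
have h6 : 0 <= c * n by rewrite mulr_ge0// ltW.
have h7 : 0 <= b * N by rewrite mulr_ge0.
have h8 : 0 <= b * n by rewrite mulr_ge0.
have h9 : 0 <= c * m by rewrite mulr_ge0// ltW.
by split; lra.
Qed.

Lemma cone_coord_uniq p v w r s :
  cone_coord p v r -> cone_coord p w s -> v = w /\ r = s.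
Proof.
have [C _ h] := cone_coord_dist => hv hw; have [+ _] := h _ _ _ _ _ _ hv hw.
rewrite mdistxx mulr0 => h0.
have := normr_ge0 (v - w); have := normr_ge0 (r - s) => n1 n2.
split; apply/eqP; rewrite -subr_eq0 -normr_le0; lra.
Qed.

Lemma cone_coord_inj p q v r : cone_coord p v r -> cone_coord q v r -> p = q.
Proof.
have [C C0 h] := cone_coord_dist => hp hq.
have [_] := h _ _ _ _ _ _ hp hq; rewrite !subrr !normr0 addr0 mulr0 => d0.
by apply: mdist_positivity; apply/eqP; rewrite eq_le d0 mdist_ge0.
Qed.

(** The radial coordinate is bounded on a closed ball, so the ball is a closed subset of a
    continuous image of [L] times a compact interval. *)
Lemma open_cone_proper : proper_space (open_cone hL).
Proof.
move=> p r; have [v [t ct]] := cone_coord_ex p.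
have [C C0 hC] := cone_coord_dist.
(* The absolute value makes [k] total on [L * R]. *)
pose k (z : L * R) : open_cone hL := cone_pt hL z.1 (NngNum (normr_ge0 z.2)).
have ck : continuous k.
  move=> [x s]; apply/metricType_numDomainType.cvgrPdist_lt => d d0.
  have d20 : 0 < d / 2 by rewrite divr_gt0.
  have s0 : 0 < `|s| + 1 by rewrite ltr_wpDl.
  exists ([set y | mdist x y < d / 2 / (`|s| + 1)],
    [set u | `|s - u| < d / 2]) => /=.
    split.
      apply/metricType_numDomainType.nbhs_mdistP.
      by exists (d / 2 / (`|s| + 1)) => //=; rewrite divr_gt0.
    by apply/nbhs_normP; exists (d / 2).
  move=> [y u] [/= h1 h2]; rewrite /k mdist_coneE /=.
  have h3 : Num.min `|s| `|u| * mdist x y <= (`|s| + 1) * mdist x y.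
    by rewrite ler_wpM2r ?mdist_ge0// ge_min lerDl ler01.
  have h4 := ler_dist_dist s u.
  move: h1; rewrite ltr_pdivlMr// => h1; lra.
have cI : compact ([set: L] `*` [set s : R | `|s| <= t + C * `|r|]).
  apply: compact_setX => //.
  have -> : [set s : R | `|s| <= t + C * `|r|] = `[- (t + C * `|r|),
    t + C * `|r|]%classic.
    by apply/seteqP; split=> s /=; rewrite in_itv/= ler_norml.
  exact: segment_compact.
have cK := continuous_compact (continuous_subspaceT ck) cI.
apply: (subclosed_compact _ cK).
  have /continuous_closedP := @continuous_mdist R (open_cone hL) p.
  by move=> /(_ _ (@closed_le R r)).
move=> q /= pq; have [w [u cu]] := cone_coord_ex q.
have [h _] := hC _ _ _ _ _ _ ct cu; case: (cu) => x [u' [qE uE _]].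
exists (x, u'%:num) => /=; last first.
  by rewrite /k qE /=; congr cone_pt; apply: val_inj; rewrite /= ger0_norm.
split=> //=; rewrite -uE ger0_norm ?(cone_coord_ge0 cu)//.
have h1 : C * mdist p q <= C * `|r|.
  by rewrite ler_wpM2l ?(ltW C0)// (le_trans pq)// ler_norm.
have := ler_norm (- (t - u)); rewrite normrN.
by have := normr_ge0 (v - w); lra.
Qed.

(** Within distance 1 of [y], values stay within [l + c] of [f y]. The shell of points at distance
    between [d] and [l + c] is compact, so its preimage is closed and misses a neighborhood of
    [y]. *)
Lemma proper_map_continuous {Y P : metricType R} (f : Y -> P)
  : proper_space P ->
  proper_map f -> asymptotically_lipschitz f -> continuous f.
Proof.
move=> pP pf [l [c [l0 c0 fl]]] y;
  apply/metricType_numDomainType.cvgrPdist_lt => d d0.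
pose K := [set p | mdist (f y) p <= l + c] `&` [set p | d <= mdist (f y) p].
have cK : compact K.
  apply: compact_closedI; first exact: pP.
  have /continuous_closedP := @continuous_mdist R P (f y).
  by move=> /(_ _ (@closed_ge R d)).
have /closed_openC oK : closed (f @^-1` K).
  by apply: compact_closed; [exact: metric_hausdorff|exact: pf].
have yK : (~` (f @^-1` K)) y by move=> [_ /=]; rewrite mdistxx leNgt d0.
have n1 : \forall z \near y, mdist y z < 1.
  by apply/metricType_numDomainType.nbhs_mdistP; exists 1; first exact: ltr01.
have n2 := open_nbhs_nbhs (conj oK yK).
near=> z; have /not_andP[] : (~` (f @^-1` K)) z.
- by near: z; exact: n2.
- have h : l * mdist y z <= l by rewrite ler_piMr ?(ltW l0)// ltW//; near: z.
  by case; apply: le_trans (fl y z) _; rewrite /= lerD2r.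
- by move=> /negP; rewrite -ltNge.
Unshelve. all: by end_near. Qed.

(** Coordinates are Lipschitz functions of the cone point, and a bound on the radius places [f y] in
    a compact ball of the cone. *)
Lemma cone_map_coordinates {Y : metricType R} (y0 : Y) (f : Y -> open_cone hL) :
  proper_map f -> asymptotically_lipschitz f ->
  exists (k : Y -> 'rV[R]_(em_dim M)) (t : Y -> R),
    [/\ coarse_lip k, coarse_lip t, proper_fun y0 t &
      forall y, cone_coord (f y) (k y) (t y)].
Proof.
move=> pf fl; have cf := proper_map_continuous open_cone_proper pf fl.
have /choice[k /choice[t ht]] : forall y, exists k t, cone_coord (f y) k t.
  by move=> y; exact: cone_coord_ex.
have [C C0 hC] := cone_coord_dist; have [l [c [l0 c0 flc]]] := fl.
have hk y z : `|k y - k z| <= C * mdist (f y) (f z).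
  have [+ _] := hC _ _ _ _ _ _ (ht y) (ht z); apply: le_trans.
  by rewrite lerDl.
have ht' y z : `|t y - t z| <= C * mdist (f y) (f z).
  have [+ _] := hC _ _ _ _ _ _ (ht y) (ht z); apply: le_trans.
  by rewrite lerDr.
have cl (V : normedModType R) (u : Y -> V) :
    (forall y z, `|u y - u z| <= C * mdist (f y) (f z)) -> coarse_lip u.
  move=> hu; split.
    move=> y; apply/cvgrPdist_lt => d d0.
    have dC0 : 0 < d / C by rewrite divr_gt0.
    have /metricType_numDomainType.cvgrPdist_lt/(_ _ dC0) := cf y.
    apply: filterS => z; rewrite ltr_pdivlMr// mulrC;
      exact: le_lt_trans (hu y z).
  exists (C * (l + c)); first by rewrite mulr_ge0 ?addr_ge0 ?ltW.
  move=> y z; apply: le_trans (hu y z) _; rewrite -mulrA ler_wpM2l ?(ltW C0)//.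
  apply: le_trans (flc y z) _; have m0 := mdist_ge0 y z.
  have : 0 <= c * mdist y z by rewrite mulr_ge0// ltW.
  lra.
exists k, t; split=> //; [exact: cl|exact: cl|].
(* For [t y <= N], each of [|k y0 - k y|] and [|t y0 - t y|] is at most [N + t y0]. *)
move=> N; have cB : compact [set p | mdist (f y0) p <=
  C * (N + t y0 + N + t y0)].
  exact: open_cone_proper.
have [N' hN'] := compact_mdist_bounded y0 (pf _ cB).
exists N' => y yN; apply: hN'; rewrite /=.
have [_ h] := hC _ _ _ _ _ _ (ht y0) (ht y); apply: le_trans h _.
rewrite ler_wpM2l ?(ltW C0)//.
have t0 := cone_coord_ge0 (ht y0); have t1 := cone_coord_ge0 (ht y).
have := cone_coord_norm (ht y0); have := cone_coord_norm (ht y) => h1 h2.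
have := ler_normB (k y0) (k y).
have : `|t y0 - t y| <= t y0 + t y by rewrite ler_norml; apply/andP; split; lra.
by lra.
Qed.

(** Converse to the passage to coordinates: the radius is bounded on a compact set of the cone, so
    properness of [t] confines the preimage to a ball. *)
Lemma cone_map_of_coordinates {Y : metricType R}
    (k : Y -> 'rV[R]_(em_dim M)) (t : Y -> R) : proper_space Y ->
  coarse_lip k -> coarse_lip t -> (forall y0, proper_fun y0 t) ->
  (forall y, exists p, cone_coord p (k y) (t y)) ->
  exists g : Y -> open_cone hL, [/\ proper_map g, asymptotically_lipschitz g &
    forall y, cone_coord (g y) (k y) (t y)].
Proof.
move=> pY [ck [c c0 hc]] [ct [d d0 hd]] pt /choice[g hg]; exists g.
have [C C0 hC] := cone_coord_dist.
have gd y z : mdist (g y) (g z) <= C * (`|k y - k z| + `|t y - t z|).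
  by have [] := hC _ _ _ _ _ _ (hg y) (hg z).
split=> //; last first.
  exists (C * (c + d) + 1), (C * (c + d) + 1).
  have h0 : 0 <= C * (c + d) by rewrite mulr_ge0 ?(ltW C0) ?addr_ge0.
  split; [by rewrite ltr_wpDl|by rewrite ltr_wpDl|].
  move=> y z; apply: le_trans (gd y z) _.
  apply: (@le_trans _ _ (C * (c + d) * (1 + mdist y z))).
    by rewrite -mulrA ler_wpM2l ?(ltW C0)// mulrDl lerD.
  by have := mdist_ge0 y z; lra.
have cg : continuous g.
  move=> y; apply/metricType_numDomainType.cvgrPdist_lt => m m0.
  have m20 : 0 < m / (2 * C) by rewrite divr_gt0 ?mulr_gt0.
  have /cvgrPdist_lt/(_ _ m20) h1 := ck y;
    have /cvgrPdist_lt/(_ _ m20) h2 := ct y.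
  near=> z; apply: le_lt_trans (gd y z) _.
  have -> : m = C * (m / (2 * C) + m / (2 * C)) by field; rewrite gt_eqF.
  have a1 : `|k y - k z| < m / (2 * C) by near: z.
  have a2 : `|t y - t z| < m / (2 * C) by near: z.
  by rewrite ltr_pM2l// ltrD.
move=> K cK; have [[y0]|nY] := pselect (inhabited Y); last first.
  have -> : g @^-1` K = set0.
    by apply/seteqP; split=> y // _; apply: nY; exact: (inhabits y).
  exact: compact0.
have [N hN] := compact_mdist_bounded (g y0) cK.
have [N' hN'] := pt y0 (t y0 + C * N).
apply: (proper_space_compact (x0 := y0) (M := N')) => //.
  have := compact_closed (@metric_hausdorff _ _) cK.
  by move/continuous_closedP : cg; exact.
move=> y /= Ky; apply: hN'; have [h _] := hC _ _ _ _ _ _ (hg y0) (hg y).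
have := hN _ Ky => /(ler_wpM2l (ltW C0)) h'.
have := ler_norm (-(t y0 - t y)); rewrite normrN.
by have := normr_ge0 (k y0 - k y); lra.
Unshelve. all: by end_near. Qed.

End maps_into_the_cone.

(** * Restriction to closed subsets, change of base point, radial scaling *)

Section restriction.
Context {R : realType} {X : metricType R}.

Lemma closed_proper_space (A : set X) :
  proper_space X -> closed A -> proper_space (set_type A).
Proof.
move=> pX cA x r.
apply: (@compact_preimage_set_val _ A [set y | mdist (set_val x) y <= r]).
rewrite setIC; apply: compact_closedI => //; exact: pX.
Qed.

Lemma coarse_lip_restrict {V : normedModType R} (A : set X) (f : X -> V) :
  coarse_lip f -> coarse_lip (f \o set_val : A -> V).
Proof.
move=> [cf [c c0 fc]]; split; last by exists c => // x y; exact: fc.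
by move=> x; apply: continuous_comp; [exact: continuous_set_val|exact: cf].
Qed.

Lemma proper_fun_base (x0 x1 : X) (t : X -> R)
  : proper_fun x0 t -> proper_fun x1 t.
Proof.
move=> pt N; have [M hM] := pt N; exists (mdist x1 x0 + M) => x /hM h.
by have := metric_triangle x1 x0 x; lra.
Qed.

Lemma proper_fun_restrict (x0 : X) (A : set X) (a0 : A) (t : X -> R) :
  proper_fun x0 t -> proper_fun a0 (t \o set_val).
Proof.
move=> /(proper_fun_base (set_val a0)) pt N; have [M hM] := pt N.
by exists M => a /hM.
Qed.

(** Makes the cone point of direction [G] and radius [s] depend on [x] in an asymptotically
    Lipschitz way: [s] must grow slowly where [G] oscillates. *)
Lemma coarse_lipZ {V : normedModType R} (s : X -> R) (G : X -> V) (C : R) :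
  0 <= C -> coarse_lip s -> (forall x, 0 <= s x) -> continuous G ->
  (forall x, `|G x| <= 1) ->
  (forall x y, s x * `|G x - G y| <= C * (1 + mdist x y)) ->
  coarse_lip (fun x => s x *: G x).
Proof.
move=> C0 [cs [c c0 hc]] s0 cG G1 H; split.
  exact: continuous_scale cs cG.
exists (C + c); first exact: addr_ge0.
move=> x y; apply: le_trans (scale_dist _ _ _ _) _; rewrite mulrDl ger0_norm//.
by rewrite lerD// (le_trans _ (hc x y))// ler_piMr.
Qed.

End restriction.

(** * Consequences of the Euclidean model *)

Section model_lemmas.
Context {R : realType} {L : metricType R}.
Variable M : euclidean_model L.

Lemma em_map_inj : injective (em_map M).
Proof.
have [a a0 ha] := em_lower M; move=> x y exy; apply: mdist_positivity.
have := ha x y; rewrite exy subrr normr0 pmulr_rle0// => h.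
by apply/eqP; rewrite eq_le h mdist_ge0.
Qed.

Lemma em_defect_map1 x : em_defect (em_map M x) 1 = 0.
Proof. by rewrite -[em_map M x]scale1r em_defect_map. Qed.

Lemma em_defect_lip1 : lip (fun v => em_defect (e:=M) v 1).
Proof.
have [c c0 hc] := em_defect_lip M; exists c => // v w.
by apply: le_trans (hc v w 1 1) _; rewrite subrr normr0 addr0.
Qed.

Lemma em_map_continuous : continuous (em_map M).
Proof.
by have [b b0 hb] := em_upper M; have [] := coarse_lip_lipschitz b0 hb.
Qed.

Lemma continuous_em_map {T : topologicalType} (g : T -> L) :
  continuous (fun x => em_map M (g x)) -> continuous g.
Proof.
have [a a0 ha] := em_lower M => cg x.
apply/metricType_numDomainType.cvgrPdist_lt => d d0.
have ad0 : 0 < a * d by rewrite mulr_gt0.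
have /cvgrPdist_lt/(_ _ ad0) := cg x.
by apply: filterS => y /(le_lt_trans (ha _ _)); rewrite ltr_pM2l.
Qed.

End model_lemmas.

(** * Extension of row-valued maps from the corona *)

Section corona_rows.
Context {R : realType} {X : metricType R}.
Hypothesis X_proper : proper_space X.
Variable x0 : X.

Lemma corona_extension_row n (C : set (higson_corona X)) (f : C -> 'rV[R]_n) :
  closed C -> continuous f -> (forall c, `|f c| <= 1) ->
  exists2 psi : X -> 'rV[R]_n, higson_map x0 psi &
    forall c : C, higson_eval_row psi (set_val (set_val c)) = f c.
Proof.
move=> clC cf f1.
have /choice[psi hpsi] : forall i, exists psi : X -> R, higson_map x0 psi /\
    forall c : C, higson_eval psi (set_val (set_val c)) = f c ord0 i.
  move=> i; have [|psi h1 h2]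
    := corona_extension X_proper x0 clC (continuous_coord (i := i) cf) ltr01.
    by move=> c; apply: le_trans (row_coord_le _ _) (f1 c).
  by exists psi.
have E i : (fun x => (\row_j psi j x : 'rV[R]_n) ord0 i) = psi i.
  by apply/funext => x; rewrite mxE.
exists (fun x => \row_j psi j x).
  by apply: higson_row => i; rewrite E; case: (hpsi i).
by move=> c; apply/rowP => i; rewrite mxE E; case: (hpsi i).
Qed.

End corona_rows.

(** * From extension into the cone to extension from the corona *)

Section cone_to_corona.
Context {R : realType} {X L : metricType R}.
Variables (M : euclidean_model L) (hL : diameter_le1 L).
Hypotheses (cL : compact [set: L]) (X_proper : proper_space X).
Variable x0 : X.

Let e := em_map M.
Let r := em_retr (e := M).
Let defect v := em_defect (e := M) v 1.

Lemma cone_to_corona :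
  kuratowski_tau X (open_cone hL) -> ext_dim_le (higson_corona X) L.
Proof.
move=> tau C phi clC cphi.
have cephi : continuous (e \o phi).
  by move=> c; apply: continuous_comp; [exact: cphi|exact: em_map_continuous].
have [psi hpsi psiE] :=
  corona_extension_row X_proper x0 clC cephi (fun c => em_map_le1 M (phi c)).
have [cpsi _ _] := hpsi.
have [s [cs s0 ps sosc]] := higson_scale hpsi.
(* The threshold is below 1, so [r] lands in [e(L)] on [A], and positive, so [A] surrounds the
   points where [psi] lies in [e(L)]. *)
pose A := [set x | defect (psi x) <= 1 / 2].
have cdef : continuous (defect \o psi)
  := continuous_lip (em_defect_lip1 M) cpsi.
have clA : closed A.
  by move/continuous_closedP : cdef => /(_ _ (@closed_le R (1 / 2))).
have crpsi : continuous (r \o psi) := continuous_lip (em_retr_lip M) cpsi.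
have [K K0 rK] := em_retr_lip M.
have ck : coarse_lip (fun x => s x *: r (psi x)).
  apply: (coarse_lipZ K0 cs s0 crpsi) => [x|x y]; first exact: em_retr_le1.
  have := ler_wpM2l (s0 x) (rK (psi x) (psi y)); rewrite mulrCA => /le_trans;
    apply.
  by rewrite ler_wpM2l.
have [a|f [pf lf fE]] := @cone_map_of_coordinates R L M hL A
    ((fun x => s x *: r (psi x)) \o set_val) (s \o set_val)
    (closed_proper_space X_proper clA) (coarse_lip_restrict A ck)
      (coarse_lip_restrict A cs)
    (fun a => proper_fun_restrict a ps).
  have aA : defect (psi (set_val a)) < 1 by have := set_valP a; rewrite /A /=;
    lra.
  have [l /= hl] := em_retr_defect aA.
  by exists (cone_pt hL l (NngNum (s0 (set_val a)))); rewrite /= /r hl;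
    exact: cone_coord_pt.
have [g [pg lg gE]] := tau A f clA pf lf.
have [k' [t' [ck' ct' pt' gE']]] := cone_map_coordinates M cL x0 pg lg.
have kA x : A x -> k' x = s x *: r (psi x) /\ t' x = s x.
  move=> Ax; pose a : A := SigSub (mem_set Ax).
  by apply: (cone_coord_uniq (gE' x)); have := fE a; rewrite -gE.
pose u x := (Num.max (t' x) 1)^-1 *: k' x.
have hu : higson_map x0 u.
  apply: higson_quotient => // x.
  by rewrite le_max (cone_coord_norm (gE' x)).
have [M1 hM1] := pt' 1; have [M2 hM2] := ps 1.
have far x : Num.max M1 M2 < mdist x0 x -> 1 < t' x /\ 1 < s x.
  rewrite gt_max => /andP[h1 h2]; split; rewrite ltNge; apply/negP.
    by move=> /hM1; rewrite leNgt h1.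
  by move=> /hM2; rewrite leNgt h2.
have ue x : Num.max M1 M2 < mdist x0 x -> exists l, u x = e l.
  move=> /far[t1 _]; have [l [t [_ _ kE]]] := gE' x; exists l.
  rewrite /u max_l ?ltW// kE scalerA mulVf ?scale1r//.
  by rewrite gt_eqF// (lt_trans _ t1).
pose ub := higson_eval_row u; pose pb := higson_eval_row psi.
have cub : continuous ub := @higson_eval_row_continuous R X _ u.
have cpb : continuous pb := @higson_eval_row_continuous R X _ psi.
have ubE x : ub (higson_embedding x) = u x
  := higson_eval_row_embedding X_proper x hu.
have pbE x : pb (higson_embedding x) = psi x
  := higson_eval_row_embedding X_proper x hpsi.
(* Membership of [u x] in [e(L)] is encoded by two continuous identities, which pass to the corona
   and give it back there: zero defect makes [r (ub z)] a point of [e(L)], and [r] fixes [ub z]. *)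
have ub_retr z : higson_corona X z -> r (ub z) = ub z.
  apply: (corona_eq X_proper (x0 := x0) (F := r \o ub) (G := ub) (M
    := Num.max M1 M2)) => //.
    exact: continuous_lip (em_retr_lip M) cub.
  by move=> x /ue[l ul]; rewrite /= ubE ul /r em_retrK.
have ub_defect z : higson_corona X z -> defect (ub z) = 0.
  apply: (corona_eq X_proper (x0 := x0) (F := defect \o ub) (G := fun=> 0) (M
    := Num.max M1 M2)).
  - exact: continuous_lip (em_defect_lip1 M) cub.
  - by move=> ?; exact: cst_continuous.
  - by move=> x /ue[l ul]; rewrite /= ubE ul /defect em_defect_map1.
(* The cutoff [w] turns an identity known only on [A] into one valid everywhere far out, so that it
   passes to the corona. *)
pose w z := Num.max 0 (1 / 2 - defect (pb z)).
have cw : continuous w.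
  have cd := continuous_lip (em_defect_lip1 M) cpb.
  apply: (continuous_dominated (C := 1) cd cd) => y z; rewrite mul1r /w.
  apply: le_trans (max_dist _ _ _ _) _; rewrite subrr normr0 add0r.
  have -> : 1 / 2 - defect (pb y) - (1 / 2 - defect (pb z)) =
    - (defect (pb y) - defect (pb z)) by ring.
  by rewrite normrN /= lerDl.
have crpb : continuous (r \o pb) := continuous_lip (em_retr_lip M) cpb.
have ub_psi z : higson_corona X z -> w z *: (ub z - r (pb z)) = 0.
  apply: (corona_eq X_proper (x0 := x0) (F := fun z => w z *: (ub z - r (pb z)))
    (G := fun=> 0) (M := Num.max M1 M2)).
  - exact: continuous_scale cw (continuous_subf cub crpb).
  - by move=> ?; exact: cst_continuous.
  move=> x /far[t1 s1]; rewrite /w ubE pbE.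
  have [xA|xA] := leP (defect (psi x)) (1 / 2); last first.
    by rewrite max_l ?scale0r//; lra.
  have [kE tE] := kA x xA; rewrite /u kE tE (max_l (ltW s1)) scalerA mulVf
    ?scale1r ?subrr ?scaler0//.
  by rewrite gt_eqF// (lt_trans _ s1).
have /choice[G hG] : forall z : higson_corona X, exists l, e l = ub (set_val z).
  move=> z; have zc : higson_corona X (set_val z) := set_valP z.
  have [l hl] : exists l, r (ub (set_val z)) = e l.
    by apply: em_retr_defect; rewrite -/(defect _) ub_defect.
  by exists l; rewrite -hl ub_retr.
exists G; split.
  apply: (continuous_em_map (M := M)).
  have -> : (fun z => em_map M (G z)) = ub \o set_val by apply/funext => z;
    exact: hG.
  by move=> z; apply: continuous_comp; [exact: continuous_set_val|exact: cub].
move=> c; apply: (@em_map_inj _ _ M); rewrite -/e hG.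
have zc : higson_corona X (set_val (set_val c)) := set_valP (set_val c).
(* On [C] the map [psi] extends [e \o phi], so the cutoff is [1 / 2] and can be cancelled. *)
have := ub_psi _ zc; rewrite /w /pb psiE /= /defect em_defect_map1 subr0
  max_r//.
move=> /eqP; rewrite scaler_eq0 gt_eqF//= subr_eq0 => /eqP ->.
exact: em_retrK.
Qed.

End cone_to_corona.

(** * From extension from the corona to extension into the cone *)

Section corona_to_cone.
Context {R : realType} {X L : metricType R}.
Variables (M : euclidean_model L) (hL : diameter_le1 L).
Hypotheses (cL : compact [set: L]) (X_proper : proper_space X).
Variables (x0 : X) (l0 : L).

Let e := em_map M.
Let r := em_retr (e := M).
Let D := em_defect (e := M).
Let defect v := D v 1.

(** Coordinates are extended one by one and then clipped to [[- t, t]], which changes nothing on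
    [A]. A bound on [F x] bounds both the radius at some [a] in [A] and the distance from [x] to
    [a], so [t] is proper. *)
Lemma cone_coordinates_extension (A : set X) (f : A -> open_cone hL) :
  closed A -> proper_map f -> asymptotically_lipschitz f ->
  exists (v : X -> 'rV[R]_(em_dim M)) (t : X -> R),
    [/\ coarse_lip v, coarse_lip t, proper_fun x0 t, forall x, `|v x| <= t x &
      forall a, cone_coord (M := M) (f a) (v (set_val a)) (t (set_val a))].
Proof.
move=> clA pf lf; have [[a0]|nA] := pselect (inhabited A); last first.
  exists (fun=> 0), (mdist x0); split=> [||N|x|a].
  - exact: coarse_lip_cst.
  - exact: coarse_lip_mdist.
  - by exists N.
  - by rewrite normr0 mdist_ge0.
  - by case: nA; exact: (inhabits a).
have [k [t0 [ck ct0 pt0 fE]]] := cone_map_coordinates M cL a0 pf lf.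
have [F [cF FE] [c c0 hF]] := coarse_lip_extension a0 clA ct0.
have /choice[K hK] : forall i, exists K : X -> R, coarse_lip K /\
    forall a, K (set_val a) = k a ord0 i.
  move=> i; have [K [cK KE] _]
    := coarse_lip_extension a0 clA (coarse_lip_coord i ck).
  by exists K.
pose t x := Num.max (F x) 0.
have tE a : t (set_val a) = t0 a.
  by rewrite /t FE max_l// (cone_coord_ge0 (fE a)).
have t_ge0 x : 0 <= t x by rewrite le_max lexx orbT.
have ct : coarse_lip t by apply: coarse_lip_max => //; exact: coarse_lip_cst.
pose v x : 'rV[R]_(em_dim M) := \row_i Num.max (- t x) (Num.min (t x) (K i x)).
have vE a : v (set_val a) = k a.
  apply/rowP => i; rewrite mxE tE (proj2 (hK i)).
  have := le_trans (row_coord_le (k a) i) (cone_coord_norm (fE a)).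
  by rewrite ler_norml => /andP[h1 h2]; rewrite min_r// max_r.
exists v, t; split=> //.
- apply: coarse_lip_row => i.
  have -> : (fun x => v x ord0 i) = fun x =>
    Num.max (- t x) (Num.min (t x) (K i x)).
    by apply/funext => x; rewrite mxE.
  apply: coarse_lip_max.
    have -> : (fun x => - t x) = (fun x => 0 - t x) by apply/funext => x;
      rewrite sub0r.
    by apply: coarse_lipB => //; exact: coarse_lip_cst.
  by apply: coarse_lip_min => //; case: (hK i).
- move=> N; have [N' hN'] := pt0 (N + 2 * c).
  exists (mdist x0 (set_val a0) + N' + (N + 2 * c) / c) => x;
    rewrite ge_max => /andP[FN _].
  have [a ha] := hF x; have t0a := cone_coord_ge0 (fE a).
  have h0 : 0 <= c * mdist x (set_val a) by rewrite mulr_ge0 ?mdist_ge0// ltW.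
  have h1 : mdist (set_val a0) (set_val a) <= N' by apply: hN'; lra.
  have h2 : mdist x (set_val a) <= (N + 2 * c) / c
    by rewrite ler_pdivlMr// mulrC; lra.
  have := metric_triangle x0 (set_val a0) x.
  have := metric_triangle (set_val a0) (set_val a) x.
  by rewrite (metric_sym (set_val a) x); lra.
- move=> x; apply: row_norm_le => // i; rewrite mxE ler_norml le_max lexx /=.
  by rewrite ge_max ge_min lexx /= andbT; have := t_ge0 x; lra.
by move=> a; rewrite vE tE; exact: fE.
Qed.

Lemma corona_to_cone :
  ext_dim_le (higson_corona X) L -> kuratowski_tau X (open_cone hL).
Proof.
move=> ext A f clA pf lf.
have [v [t [cv ct pt vt fE]]] := cone_coordinates_extension clA pf lf.
have t0 x : 0 <= t x := le_trans (normr_ge0 _) (vt x).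
have [K K0 rK] := em_retr_lip M; have [c c0 Dc] := em_defect_lip M.
(* The factor 4 ensures that [h x > 0] only where [v / t] has defect below [1 / 4], which is where
   [chi] below vanishes. *)
pose h x := Num.max 0 (t x - 4 * D (v x) (t x)).
have hh x y : `|h x - h y| <= (1 + 4 * c) * (`|v x - v y| + `|t x - t y|).
  apply: le_trans (max_dist _ _ _ _) _; rewrite subrr normr0 add0r.
  have -> : t x - 4 * D (v x) (t x) - (t y - 4 * D (v y) (t y)) =
    (t x - t y) - 4 * (D (v x) (t x) - D (v y) (t y)) by ring.
  apply: le_trans (ler_normB _ _) _; rewrite normrM ger0_norm//.
  have := Dc (v x) (v y) (t x) (t y); have := normr_ge0 (v x - v y);
    rewrite -/D; lra.
have h0 x : 0 <= h x by rewrite le_max lexx.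
have ht x : h x <= t x.
  by rewrite ge_max t0/=; have := em_defect_ge0 (e := M) (v x) (t x);
    rewrite -/D; lra.
have ch : coarse_lip h.
  by apply: (coarse_lip_dominated (C := 1 + 4 * c) _ cv ct hh); lra.
pose k x := h x *: r ((t x)^-1 *: v x).
(* Since [h <= t], [radial_dist] absorbs the factor [h]. *)
have ck : coarse_lip k.
  apply: (coarse_lip_dominated (C := K + (1 + 4 * c)) _ cv ct); first by lra.
  move=> x y; apply: le_trans (scale_dist _ _ _ _) _;
    rewrite mulrDl (ger0_norm (h0 x)).
  apply: lerD; last first.
    by apply: le_trans _ (hh x y); rewrite ler_piMr// em_retr_le1.
  apply: (@le_trans _ _ (t x * (K * `|(t x)^-1 *: v x - (t y)^-1 *: v y|))).
    by rewrite ler_pM.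
  by rewrite mulrCA ler_wpM2l// radial_dist.
pose p x := (Num.max (t x) 1)^-1 *: v x.
have hp : higson_map x0 p.
  by apply: higson_quotient => // x; rewrite le_max vt.
have pT x : 1 < t x -> p x = (t x)^-1 *: v x by move=> tx;
  rewrite /p max_l// ltW.
pose pb := higson_eval_row p.
have cpb : continuous pb := @higson_eval_row_continuous R X _ p.
have pbE x : pb (higson_embedding x) = p x
  := higson_eval_row_embedding X_proper x hp.
pose C : set (higson_corona X) := [set z | defect (pb (set_val z)) <= 1 / 2].
have cpbv : continuous (pb \o set_val : higson_corona X -> _).
  by move=> z; apply: continuous_comp; [exact: continuous_set_val|exact: cpb].
have clC : closed C.
  have /continuous_closedP := continuous_lip (em_defect_lip1 M) cpbv.
  by move=> /(_ _ (@closed_le R (1 / 2))).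
have /choice[phi hphi] : forall a : C, exists l,
  e l = r (pb (set_val (set_val a))).
  move=> a; have aC : defect (pb (set_val (set_val a))) < 1.
    by have := set_valP a; rewrite /C /=; lra.
  by have [l hl] := em_retr_defect aC; exists l.
have crpb : continuous (r \o pb) := continuous_lip (em_retr_lip M) cpb.
have cphi : continuous phi.
  apply: (continuous_em_map (M := M)).
  have -> : (fun z => em_map M (phi z)) = (r \o pb \o set_val) \o set_val.
    by apply/funext => z; exact: hphi.
  have cz : continuous (r \o pb \o set_val : higson_corona X -> _).
    by move=> z; apply: continuous_comp;
      [exact: continuous_set_val|exact: crpb].
  by move=> z; apply: continuous_comp; [exact: continuous_set_val|exact: cz].
have [G [cG GE]] := ext C phi clC cphi.
(* [G] is total, so the closed set from which it is extended to [X] is the whole corona. *)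
have ceG : continuous (fun z : [set: higson_corona X] => e (G (set_val z))).
  have c1 : continuous (e \o G).
    by move=> z; apply: continuous_comp; [exact: cG|exact: em_map_continuous].
  move=> z; apply: (@continuous_comp _ _ _ set_val (e \o G)); last exact: c1.
  exact: continuous_set_val.
have [psi hpsi psiE] := corona_extension_row X_proper x0 closedT ceG
  (fun z => em_map_le1 M (G (set_val z))).
pose sb := higson_eval_row psi.
have csb : continuous sb := @higson_eval_row_continuous R X _ psi.
have sbE x : sb (higson_embedding x) = psi x
  := higson_eval_row_embedding X_proper x hpsi.
have sbG (z : higson_corona X) : sb (set_val z) = e (G z).
  have zT : [set: higson_corona X] z by [].
  exact: (psiE (SigSub (mem_set zT))).
(* A cutoff that is 0 for defect at most [1 / 4] and 1 from [1 / 2] on, the threshold defining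
   [C]. *)
pose chi w := clamp (4 * defect w - 1).
have lchi : lip chi.
  have [d d0 hd] := em_defect_lip1 M; exists (4 * d); first by rewrite mulr_ge0.
  move=> w w'; apply: le_trans (clamp_dist _ _) _.
  have -> : 4 * defect w - 1 - (4 * defect w' - 1) = 4 * (defect w - defect w')
    by ring.
  by rewrite normrM ger0_norm// -mulrA ler_wpM2l//; exact: hd.
(* [g0] passes from [r \o p] to [psi] as the defect of [p] grows. On the corona the two agree over
   [C], and [chi] is 1 off [C], so [g0] still induces [e \o G] there. *)
pose g0 x := r (p x) + chi (p x) *: (psi x - r (p x)).
have hrp : higson_map x0 (r \o p) := higson_lip (em_retr_lip M) hp.
have hchi : higson_map x0 (chi \o p) := higson_lip lchi hp.
have hg0 : higson_map x0 g0.
  exact: higsonD hrp (higsonZ hchi (higsonB hpsi hrp)).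
pose gb := higson_eval_row g0.
have cgb : continuous gb := @higson_eval_row_continuous R X _ g0.
have gbE x : gb (higson_embedding x) = g0 x
  := higson_eval_row_embedding X_proper x hg0.
have cchi : continuous (chi \o pb) := continuous_lip lchi cpb.
have gb_pb z : higson_corona X z -> gb z - r (pb z) = chi (pb z) *: (sb z - r
  (pb z)).
  apply: (corona_eq X_proper (x0 := x0) (F := fun z => gb z - r (pb z))
    (G := fun z => chi (pb z) *: (sb z - r (pb z))) (M := 0)).
  - exact: continuous_subf cgb crpb.
  - exact: continuous_scale cchi (continuous_subf csb crpb).
  - by move=> x _; rewrite gbE pbE sbE /g0 addrC addKr.
have gb_G (z : higson_corona X) : gb (set_val z) = e (G z).
  have := gb_pb _ (set_valP z); rewrite sbG.
  have [zC|zC] := leP (defect (pb (set_val z))) (1 / 2).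
    have Cz : C z by [].
    have -> : e (G z) = r (pb (set_val z)).
      by have := GE (SigSub (mem_set Cz)); rewrite /= => ->; exact: hphi.
    by rewrite subrr scaler0 => /eqP; rewrite subr_eq0 => /eqP.
  have -> : chi (pb (set_val z)) = 1.
    by rewrite /chi /clamp min_l ?max_r//; lra.
  by rewrite scale1r => /addIr.
(* The defect of [g0] vanishes on the corona, so it is below 1 outside some ball. *)
have [M1 hM1] : exists M1, forall x, M1 < mdist x0 x -> defect (g0 x) < 1.
  have oO : open [set z | (defect \o gb) z < 1].
    have /continuousP := continuous_lip (em_defect_lip1 M) cgb.
    by move=> /(_ _ (@open_lt R 1)).
  have [z zc|N hN] := corona_nbhs X_proper x0 oO.
    pose z' : higson_corona X := SigSub (mem_set zc).
    by rewrite -[z]/(set_val z') /= gb_G /defect /D em_defect_map1 ltr01.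
  by exists N => x /hN /=; rewrite gbE.
have [s0 [cs0 s00 ps0 sosc]] := higson_scale hg0.
have [M2 hM2] := pt 1; pose M3 := Num.max M1 M2.
have [M4 M40 hM4] : exists2 M4, 0 <= M4 & forall x,
  mdist x0 x <= M3 -> s0 x <= M4.
  have [_ [d d0 hd]] := cs0; exists (s0 x0 + d * (1 + `|M3|)).
    by rewrite addr_ge0// mulr_ge0// addr_ge0.
  move=> x xM; have := hd x x0; rewrite ler_norml => /andP[_].
  have : d * (1 + mdist x x0) <= d * (1 + `|M3|).
    by rewrite ler_wpM2l// lerD2l metric_sym (le_trans xM)// ler_norm.
  lra.
(* Subtracting [M4] makes [s] vanish on the ball of radius [M3], outside which [t > 1] and [r \o g0]
   lies in [e(L)]. The minimum with [t] ensures that [s] adds no radius on [A]. *)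
pose s x := Num.max 0 (Num.min (s0 x) (t x) - M4).
have st x : s x <= t x.
  by rewrite ge_max t0 /= lerBlDr ge_min lerDl M40 orbT.
have ss0 x : s x <= s0 x.
  by rewrite ge_max s00 /= lerBlDr ge_min lerDl M40.
have sM3 x : 0 < s x -> 1 < t x /\ defect (g0 x) < 1.
  rewrite lt_max ltxx /= subr_gt0 lt_min => /andP[sx _].
  have : M3 < mdist x0 x.
    by rewrite ltNge; apply/negP => /hM4; rewrite leNgt sx.
  rewrite gt_max => /andP[/hM1 h1 h2]; split=> //.
  by rewrite ltNge; apply/negP => /hM2; rewrite leNgt h2.
have cs : coarse_lip s.
  apply: coarse_lip_max; first exact: coarse_lip_cst.
  by apply: coarse_lipB; [exact: coarse_lip_min|exact: coarse_lip_cst].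
(* [s'] is the positive part of [s - h], so [tau] is the maximum of [h] and [s], while [kap] is a
   sum of two asymptotically Lipschitz terms. *)
pose s' x := Num.max 0 (s x - h x).
have s'0 x : 0 <= s' x by rewrite le_max lexx.
have s's x : s' x <= s x.
  by rewrite ge_max lerBlDr lerDl h0 andbT le_max lexx.
have cs' : coarse_lip s'.
  apply: coarse_lip_max; first exact: coarse_lip_cst.
  exact: coarse_lipB.
pose tau x := h x + s' x; pose kap x := k x + s' x *: r (g0 x).
have ckap : coarse_lip kap.
  apply: coarse_lipD => //; apply: (coarse_lipZ K0 cs' s'0) => [|x|x y].
  - by have [cg0 _ _] := hg0; exact: (continuous_lip (em_retr_lip M) cg0).
  - exact: em_retr_le1.
  (* As [s' <= s0], the bound on [s0] times the oscillation of [g0] carries over. *)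
  apply: (@le_trans _ _ (s0 x * (K * `|g0 x - g0 y|))).
    by rewrite ler_pM// (le_trans (s's x)).
  by rewrite mulrCA ler_wpM2l.
have ctau : coarse_lip tau by exact: coarse_lipD.
have ptau : proper_fun x0 tau.
  move=> N; have [N1 hN1] := ps0 (N + M4); have [N2 hN2] := pt (N + M4).
  exists (Num.max N1 N2) => x xN.
  have : s x <= N.
    apply: le_trans xN; have : s x - h x <= s' x by rewrite le_max lexx orbT.
    by rewrite /tau; lra.
  rewrite ge_max lerBlDr ge_min => /andP[_ /orP[/hN1|/hN2] hx].
    by rewrite le_max hx.
  by rewrite le_max hx orbT.
have hdef x : 0 < h x -> 0 < t x /\ defect ((t x)^-1 *: v x) < 1 / 4.
  move=> hx; have tx : 0 < t x := lt_le_trans hx (ht x); split=> //.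
  move: hx; rewrite lt_max ltxx /= subr_gt0 => hx.
  rewrite -(ltr_pM2l tx); apply: le_lt_trans (em_defect_scale _ tx) _.
  by rewrite -/D; lra.
have coord x : exists q : open_cone hL, cone_coord (M := M) q (kap x) (tau x).
  have mk l y (y0 : 0 <= y) : exists q : open_cone hL,
    cone_coord (M := M) q (y *: e l) y.
    by exists (cone_pt hL l (NngNum y0)); exact: cone_coord_pt.
  have tau0 : 0 <= tau x by rewrite addr_ge0.
  suff [l ->] : exists l, kap x = tau x *: e l by exact: mk.
  rewrite /kap /tau /k.
  (* If both radii are positive, [chi] vanishes and [g0] equals [r (v / t)], so both terms lie on
     one ray. If only one is positive, its direction serves; at the vertex any point of [L] does. *)
  have [hx|hx] := ltP 0 (h x); have [sx|sx] := ltP 0 (s' x).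
  - have [tx dx] := hdef x hx; have [t1 _] := sM3 x (lt_le_trans sx (s's x)).
    have [l hl] : exists l, r ((t x)^-1 *: v x) = e l by apply: em_retr_defect;
      rewrite -/D -/(defect _); lra.
    exists l; have -> : g0 x = e l.
      rewrite /g0 pT// hl; have -> : chi ((t x)^-1 *: v x) = 0.
        by rewrite /chi /clamp min_r ?max_l//; lra.
      by rewrite scale0r addr0.
    by rewrite hl /r em_retrK scalerDl.
  - have [tx dx] := hdef x hx.
    have [l hl] : exists l, r ((t x)^-1 *: v x) = e l by apply: em_retr_defect;
      rewrite -/D -/(defect _); lra.
    have -> : s' x = 0 by apply/eqP; rewrite eq_le sx s'0.
    by exists l; rewrite hl scale0r !addr0.
  - have [_ gx] := sM3 x (lt_le_trans sx (s's x)).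
    have [l hl] := em_retr_defect gx.
    have -> : h x = 0 by apply/eqP; rewrite eq_le hx h0.
    by exists l; rewrite /r hl scale0r !add0r.
  - have -> : s' x = 0 by apply/eqP; rewrite eq_le sx s'0.
    have -> : h x = 0 by apply/eqP; rewrite eq_le hx h0.
    by exists l0; rewrite !scale0r !addr0 scale0r.
have [g [pg lg gE]] := cone_map_of_coordinates X_proper ckap ctau
  (fun y => proper_fun_base y ptau) coord.
exists g; split=> // a; apply: (cone_coord_inj (gE (set_val a))).
have [l [u [_ _ vE]]] := fE a.
(* On [A] the defect vanishes, so [h = t], and [s <= t] leaves nothing to add. *)
have hE : h (set_val a) = t (set_val a).
  by rewrite /h vE /D em_defect_map mulr0 subr0 max_r.
have sE : s' (set_val a) = 0.
  by rewrite /s' hE max_l// subr_le0.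
have -> : tau (set_val a) = t (set_val a) by rewrite /tau hE sE addr0.
have -> : kap (set_val a) = v (set_val a).
  rewrite /kap /k hE sE scale0r addr0 vE.
  have [->|tn0] := eqVneq (t (set_val a)) 0; first by rewrite !scale0r.
  by rewrite scalerA mulVf// scale1r /r em_retrK.
exact: fE.
Qed.

End corona_to_cone.

Theorem theorem4p1 (R : realType) (X L : metricType R)
    (X_proper : proper_space X) (L_nonempty : [set: L] !=set0)
    (L_alner : compact_ALNER L) (L_diam : diameter_le1 L) :
  as_ext_dim_le X (open_cone L_diam) <-> ext_dim_le (higson_corona X) L.
Proof.
have [l0 _] := L_nonempty; have [cL _] := L_alner.
have [M _] := alner_model L_nonempty L_alner.
(* An empty [X] has no base point; its corona is empty, and constant maps extend on both sides. *)
have [[x0]|nX] := pselect (inhabited X); last first.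
  have nX' (x : X) : False := nX (inhabits x).
  split=> _.
    move=> C f _ _; have nZ (z : higson_corona X) : False.
      have [zX _] := set_valP z.
      have [p [[x _ _] _]] := zX _ filterT; exact: (nX' x).
    by exists (fun=> l0); split=> [z|c]; [case: (nZ z)|case: (nZ (set_val c))].
  move=> A f _ _ _; exists (fun=> cone_pt L_diam l0 0%:nng); split=> [K _||a].
  - rewrite (_ : _ @^-1` K = set0); first exact: compact0.
    by apply/seteqP; split=> x; case: (nX' x).
  - by exists 1, 1; split=> // x; case: (nX' x).
  - by case: (nX' (set_val a)).
split; first exact: (cone_to_corona M cL X_proper x0).
exact: (corona_to_cone M cL X_proper x0 l0).
Qed.
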